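(* Let $A\subseteq\mathbb{R}^n$ be a linearly independent set of vectors with entries in $\{0,1,-1\}$. Then $A$ is a te-set if and only if $A$ is the disjoint union of mutually-tu te-bricks. More precisely, $A$ is a te-set if and only if $$A=U\sqcup L_1\sqcup\dots\sqcup L_k\sqcup S_1\sqcup\dots\sqcup S_\ell\sqcup T_1\sqcup\dots\sqcup T_m$$ where $U$ is a (possibly empty) tu-set, $L_1,\dots,L_k$ are te-laces, $S_1,\dots,S_\ell$ are thin te-interlaces, $T_1,\dots,T_m$ are thick te-interlaces, and these te-bricks are mutually-tu.
   Context: A set of vectors is identified with the matrix whose rows are these vectors. An $m\times n$ matrix is equimodular if it has full row rank $m$ and all its nonzero $m\times m$ minors have the same absolute value; this common absolute value is its equideterminant $\operatorname{eqdet}$. A matrix is totally equimodular if every set of linearly independent rows forms an equimodular matrix, and totally unimodular if all its square submatrices have determinant in $\{0,\pm1\}$. A linearly independent set of $\{0,\pm1\}$-vectors is: a te-set if its matrix is totally equimodular; a tu-set if its matrix is totally unimodular; a te-lace if it is a te-set, not a tu-set, and all its proper subsets are tu-sets; a te-interlace if it is a te-set, not a tu-set, and every pair of its vectors is a te-lace. A te-interlace of size $\ell$ is thin if its equideterminant is $2^{\ell-1}$ and thick if it is $2^{\ell}$. A te-brick is a tu-set, a te-lace, a thin te-interlace, or a thick te-interlace. Pairwise disjoint te-bricks are mutually-tu if every subset $X$ of their union which intersects at least two of them, contains none of those te-bricks that are te-laces, and contains at most one vector of each of those te-bricks that are te-interlaces, is a tu-set. *)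

(* Defs.v *)
From HB Require Import structures.
From mathcomp Require Import all_boot all_order all_algebra.
From mathcomp Require Import finmap.
From Stdlib Require Reals.
From mathcomp Require Import Rstruct.
Set Implicit Arguments. Unset Strict Implicit. Unset Printing Implicit Defensive.
Import Order.TTheory GRing.Theory Num.Theory.
Local Open Scope ring_scope.
Local Open Scope fset_scope.

Notation vec n := 'rV[Rdefinitions.R]_n.

(* a strictly increasing map of ordinals: selects a subset of indices in order *)
Definition incr (k m : nat) (f : 'I_k -> 'I_m) : Prop :=
  forall i j : 'I_k, (nat_of_ord i < nat_of_ord j)%N -> (nat_of_ord (f i) < nat_of_ord (f j))%N.

Definition has_eqdet (m n : nat) (M : 'M[Rdefinitions.R]_(m, n)) (d : Rdefinitions.R) : Prop :=
  row_free M /\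
  (exists f : 'I_m -> 'I_n, incr f /\ \det (colsub f M) != 0) /\
  (forall f : 'I_m -> 'I_n, incr f -> \det (colsub f M) != 0 ->
      `|\det (colsub f M)| = d).

Definition equimodular (m n : nat) (M : 'M[Rdefinitions.R]_(m, n)) : Prop :=
  row_free M /\
  (forall f g : 'I_m -> 'I_n, incr f -> incr g ->
     \det (colsub f M) != 0 -> \det (colsub g M) != 0 ->
     `|\det (colsub f M)| = `|\det (colsub g M)|).

Definition totally_equimodular (p n : nat) (M : 'M[Rdefinitions.R]_(p, n)) : Prop :=
  forall (k : nat) (g : 'I_k -> 'I_p), incr g ->
    row_free (rowsub g M) -> equimodular (rowsub g M).

Definition totally_unimodular (p n : nat) (M : 'M[Rdefinitions.R]_(p, n)) : Prop :=
  forall (k : nat) (g : 'I_k -> 'I_p) (f : 'I_k -> 'I_n), incr g -> incr f ->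
    \det (mxsub g f M) \in [:: 0; 1; -1].

(* the matrix whose rows are the vectors of A (in the order of enum_fset A;
   all notions used below are invariant under row permutations) *)
Definition mx_of (n : nat) (A : {fset vec n}) : 'M[Rdefinitions.R]_(size (enum_fset A), n) :=
  \matrix_(i < size (enum_fset A), j < n) (nth 0 (enum_fset A) i) 0 j.

Definition entries01 (n : nat) (v : vec n) : Prop :=
  forall j : 'I_n, v 0 j \in [:: 0; 1; -1].

Definition indep01 (n : nat) (A : {fset vec n}) : Prop :=
  (forall v, v \in A -> entries01 v) /\ row_free (mx_of A).

Definition te_set (n : nat) (A : {fset vec n}) : Prop :=
  indep01 A /\ totally_equimodular (mx_of A).

Definition tu_set (n : nat) (A : {fset vec n}) : Prop :=
  indep01 A /\ totally_unimodular (mx_of A).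

Definition te_lace (n : nat) (A : {fset vec n}) : Prop :=
  te_set A /\ ~ tu_set A /\ (forall B : {fset vec n}, fproper B A -> tu_set B).

Definition te_interlace (n : nat) (A : {fset vec n}) : Prop :=
  te_set A /\ ~ tu_set A /\
  (forall x y, x \in A -> y \in A -> x != y -> te_lace [fset x; y]).

Definition thin_te_interlace (n : nat) (A : {fset vec n}) : Prop :=
  te_interlace A /\ has_eqdet (mx_of A) (2 ^+ (#|` A|.-1)).

Definition thick_te_interlace (n : nat) (A : {fset vec n}) : Prop :=
  te_interlace A /\ has_eqdet (mx_of A) (2 ^+ #|` A|).

Definition te_brick (n : nat) (A : {fset vec n}) : Prop :=
  tu_set A \/ te_lace A \/ thin_te_interlace A \/ thick_te_interlace A.

(* the te-bricks in the list bs (assumed pairwise disjoint) are mutually-tu *)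
Definition mutually_tu (n : nat) (bs : seq {fset vec n}) : Prop :=
  forall X : {fset vec n},
    fsubset X (\bigcup_(B <- bs) B) ->
    (2 <= count (fun B => fsetI X B != fset0) bs)%N ->
    (forall B, B \in bs -> te_lace B -> ~ fsubset B X) ->
    (forall B, B \in bs -> te_interlace B -> (#|` fsetI X B| <= 1)%N) ->
    tu_set X.

Definition pairwise_disjoint (n : nat) (bs : seq {fset vec n}) : Prop :=
  forall i j : nat, (i < size bs)%N -> (j < size bs)%N -> i <> j ->
    fsetI (nth fset0 bs i) (nth fset0 bs j) = fset0.

(* Main.v *)
(* Every subset Y of a te-set has equideterminant 2^e(Y). Jacobi's identity for the
   2x2 minors of the inverse of a basis shows that the gap
   e(Y) + e(Y - i - i') - e(Y - i) - e(Y - i') is 0 or 1, and in either case it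
   forces a rigid shape of that inverse: its columns i, i' have the same support
   (gap 1), or are proportional wherever two rows are nonzero in both (gap 0).
   The minimal sets with e > 0 are the te-laces; each has a signed sum of rows
   divisible by 2, so they generate a binary code, and two distinct te-laces that
   meet are pairs. Hence te-laces of size at least 3 and the classes of the
   relation "x = y or {x, y} is a te-lace" are disjoint, and what remains is a
   tu-set. The same analysis modulo 4, applied inside a class S to the excess
   e(Y) - (|Y| - 1), gives e(S) = |S| - 1 or |S|: S is thin or thick.

   Conversely, the exponents of mutually-tu bricks add up. By induction on Y, a
   lace contained in Y is handled by applying the gap identity to two pairs of
   rows, and two rows of Y in the same interlace by pivoting on the rows of Y
   outside that interlace. *)
Require Import Defs.
From HB Require Import structures.
From mathcomp Require Import all_boot all_order all_algebra.
From mathcomp Require Import finmap.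
From Stdlib Require Reals.
From mathcomp Require Import Rstruct.
From Stdlib Require Import Classical_Prop.
From mathcomp Require Import perm ring lra zify.
Set Implicit Arguments. Unset Strict Implicit. Unset Printing Implicit Defensive.
Import Order.TTheory GRing.Theory Num.Theory.
Local Open Scope ring_scope.

(** * Minors indexed by row sets *)

(** Why the inverse of a basis carries the argument: its entry at row [i] of [Y] is, up to sign, a
    minor of [Y :\ i] divided by one of [Y], and a 2x2 minor of it is a minor of [Y :\ i :\ i']
    divided by one of [Y]. Equimodularity of the smaller sets therefore fixes the absolute value of
    all nonzero entries in a column, and of all nonzero 2x2 minors in two columns. Such a 2x2 minor
    is a difference of two products, each zero or of one common absolute value [m], so it is 0, [m]
    or [2 m] in absolute value. The factor 2 between the last two is the only source of powers of
    two; [m] requires a zero product and [2 m] two nonzero ones, which is what makes the shape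
    rigid. The combinatorics after this point uses only the gap, the two shapes, and the fact that
    nonempty words have positive value. It is isolated in [word_system] because it has to run twice,
    for the exponent and for the excess inside an interlace. *)

Section Determinants.
Variable R : comUnitRingType.

(** Sylvester's determinant identity, read off from a block factorization. It reduces a matrix that
    differs from the identity in [k] rows to a [k] by [k] determinant. *)
Lemma det_one_add_mulmx (p k : nat) (U : 'M[R]_(p, k)) (V : 'M[R]_(k, p)) :
  \det (1%:M + U *m V) = \det (1%:M + V *m U).
Proof.
have e1 : block_mx 1%:M 0 V 1%:M *m block_mx (1%:M + U *m V) U 0 1%:M
    *m block_mx 1%:M 0 (- V) 1%:M = block_mx 1%:M U 0 (1%:M + V *m U).
  rewrite !mulmx_block !mul1mx !mul0mx !mulmx1 !mulmx0 !addr0 !add0r.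
  congr block_mx.
  - by rewrite mulmxN addrK.
  - by rewrite mulmxN mulmxDr mulmx1 mulmxDl mul1mx mulmxA addrC (addrC V) addNr.
  - by rewrite addrC.
move: (congr1 (fun M => \det M) e1).
by rewrite !det_mulmx !det_lblock !det_ublock !det1 !mul1r !mulr1.
Qed.

(** If [U] is the 0/1 matrix placing row [l] at position [h l], then [N = 1 + U (V - U^T)] and
    [U^T U = 1], so Sylvester's identity leaves [det (V U)]. *)
Lemma det_replace_rows (p k : nat) (h : 'I_k -> 'I_p) (V : 'M[R]_(k, p)) (N : 'M[R]_p) :
  injective h -> (forall l j, N (h l) j = V l j) ->
  (forall i j, (forall l, h l != i) -> N i j = (i == j)%:R) ->
  \det N = \det (colsub h V).
Proof.
move=> hI Nh Ni.
pose U : 'M[R]_(p, k) := \matrix_(i, l) (i == h l)%:R.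
have -> : N = 1%:M + U *m (V - U^T).
  apply/matrixP => i j; rewrite !mxE.
  have [/existsP[l /eqP hl]|/existsPn nh] := boolP [exists l, h l == i].
    rewrite -hl Nh (bigD1 l) //= big1 => [|l' ll']; last first.
      by rewrite !mxE (inj_eq hI) eq_sym (negPf ll') mul0r.
    by rewrite !mxE eqxx mul1r addr0 (eq_sym j) addrC subrK.
  rewrite Ni // big1 ?addr0 // => l _.
  by rewrite !mxE eq_sym (negPf (nh l)) mul0r.
rewrite det_one_add_mulmx mulmxBl.
have -> : U^T *m U = 1%:M.
  apply/matrixP => l l'; rewrite !mxE (bigD1 (h l)) //= big1 => [|i il].
    by rewrite !mxE eqxx mul1r addr0 (inj_eq hI).
  by rewrite !mxE (negPf il) mul0r.
rewrite addrC subrK; congr (\det _); apply/matrixP => l l'.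
rewrite !mxE (bigD1 (h l')) //= big1 => [|i il].
  by rewrite !mxE eqxx mulr1 addr0.
by rewrite !mxE (negPf il) mulr0.
Qed.

(** Laplace expansion with a comparison matrix [N] in place of a cofactor: padded matrices of
    different row sets can then be compared without reindexing. *)
Lemma det_col_delta (p : nat) (r : 'I_p) (M N : 'M[R]_p) :
  (forall i, i != r -> M i r = 0) -> (forall i, i != r -> N i r = 0) -> N r r = 1 ->
  (forall i j, i != r -> j != r -> M i j = N i j) -> \det M = M r r * \det N.
Proof.
move=> M0 N0 N1 MN.
have colE (P : 'M[R]_p) : (forall i, i != r -> P i r = 0) -> \det P = P r r * cofactor P r r.
  move=> P0; rewrite (expand_det_col P r) (bigD1 r) //= big1 ?addr0 // => i ir.
  by rewrite P0 ?mul0r.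
rewrite !colE // N1 mul1r; congr (_ * (_ * \det _)); apply/matrixP => i j.
by rewrite !mxE MN // eq_sym neq_lift.
Qed.

Lemma det_row_delta (p : nat) (r : 'I_p) (M N : 'M[R]_p) :
  (forall j, j != r -> M r j = 0) -> (forall j, j != r -> N r j = 0) -> N r r = 1 ->
  (forall i j, i != r -> j != r -> M i j = N i j) -> \det M = M r r * \det N.
Proof.
move=> M0 N0 N1 MN; rewrite -(det_tr M) -(det_tr N).
rewrite (@det_col_delta _ r M^T N^T) ?mxE // => [i|i|i j] *; rewrite !mxE ?M0 ?N0 ?MN //.
Qed.

End Determinants.

Section PrincipalMinors.
Variables (R : realFieldType) (p n : nat).
Implicit Types (A : 'M[R]_(p, n)) (X Y Z : {set 'I_p}) (f g : 'I_p -> 'I_n).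

(* The minor of A with row set Y and columns f(Y), padded by an identity matrix
   outside Y, so that no enumeration of Y is needed. *)
Definition padded A Y f : 'M[R]_p :=
  \matrix_(i, j) if (i \in Y) && (j \in Y) then A i (f j) else (i == j)%:R.

Definition minor A Y f : R := \det (padded A Y f).

Lemma minor_enum A (k : nat) (h : 'I_k -> 'I_p) f : injective h ->
  minor A [set h l | l in 'I_k] f = \det (mxsub h (f \o h) A).
Proof.
move=> hI; set Y := [set _ | _ in _].
have hY l : h l \in Y by apply: imset_f.
rewrite /minor (@det_replace_rows _ _ _ h
  (\matrix_(l, j) if j \in Y then A (h l) (f j) else 0)) //.
- by congr (\det _); apply/matrixP => l l'; rewrite !mxE hY.
- move=> l j; rewrite !mxE hY /=; case: ifP => // jY.
  by case: eqP => // hj; rewrite -hj hY in jY.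
- move=> i j ih; rewrite !mxE; case: (boolP (i \in Y)) => //= /imsetP[l _ hl].
  by move: (ih l); rewrite hl eqxx.
Qed.

Lemma eq_minor A A' Y f f' :
  (forall i j, i \in Y -> j \in Y -> A i (f j) = A' i (f' j)) -> minor A Y f = minor A' Y f'.
Proof.
move=> e; congr (\det _); apply/matrixP => i j; rewrite !mxE.
by case: ifP => // /andP[iY jY]; apply: e.
Qed.

Lemma minor0 A f : minor A set0 f = 1.
Proof.
rewrite /minor (_ : padded _ _ _ = 1%:M) ?det1 //.
by apply/matrixP => i j; rewrite !mxE inE.
Qed.

Lemma minor1 A i f : minor A [set i] f = A i (f i).
Proof.
rewrite /minor (@det_col_delta _ _ i _ 1%:M) ?det1 ?mulr1.
- by rewrite !mxE !inE eqxx.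
- by move=> j ji; rewrite !mxE !inE (negPf ji).
- by move=> j ji; rewrite !mxE (negPf ji).
- by rewrite mxE eqxx.
- by move=> j l ji li; rewrite !mxE !inE (negPf ji).
Qed.

Lemma minor_zero_row A Y f i : i \in Y -> (forall j, j \in Y -> A i (f j) = 0) -> minor A Y f = 0.
Proof.
move=> iY e; rewrite /minor (expand_det_row _ i) big1 // => j _.
rewrite !mxE iY /=; case: ifP => [jY|jY]; first by rewrite e ?mul0r.
case: eqP => [ij|_]; last by rewrite mul0r.
by rewrite -ij iY in jY.
Qed.

Lemma minor_zero_col A Y f j : j \in Y -> (forall i, i \in Y -> A i (f j) = 0) -> minor A Y f = 0.
Proof.
move=> jY e; rewrite /minor (expand_det_col _ j) big1 // => i _.
rewrite !mxE jY andbT; case: ifP => [iY|iY]; first by rewrite e ?mul0r.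
case: eqP => [ij|_]; last by rewrite mul0r.
by rewrite ij jY in iY.
Qed.

Lemma minor_tperm A Y f i j : i \in Y -> j \in Y ->
  `|minor A Y (f \o tperm i j)| = `|minor A Y f|.
Proof.
move=> iY jY.
have tY k : (tperm i j k \in Y) = (k \in Y).
  by case: tpermP => [->|->|]; rewrite ?iY ?jY.
have kn k x : (k \in Y) = false -> x \in Y -> (k == x) = false.
  by move=> kY xY; apply: contraFF kY => /eqP ->.
have -> : minor A Y (f \o tperm i j) = \det (xcol i j (padded A Y f)).
  congr (\det _); apply/matrixP => k l; rewrite !mxE tY /=.
  case: ifP => // kl; case: tpermP => // l'; subst l; move: kl; rewrite ?iY ?jY andbT => kY.
    by rewrite (kn _ _ kY iY) (kn _ _ kY jY).
  by rewrite (kn _ _ kY iY) (kn _ _ kY jY).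
by rewrite xcolE det_mulmx det_perm normrM normrX normrN1 expr1n mulr1.
Qed.

(** A Schur complement step: [E] has determinant 1 and subtracts multiples of row [r] from the rows
    in [X], which clears column [r] off the diagonal. *)
Lemma pivot_minor A X f r b (A' : 'M[R]_(p, n)) : r \notin X -> A r b != 0 -> f r = b ->
  (forall i c, i != r -> A' i c = A i c - A i b / A r b * A r c) ->
  minor A (r |: X) f = A r b * minor A' X f.
Proof.
move=> rX Arb fr A'E.
have ner i : i \in X -> i != r by apply: contraTN => /eqP ->.
pose u : 'cV[R]_p := \col_i (if i \in X then - (A i b / A r b) else 0).
pose E := 1%:M + u *m delta_mx 0 r.
have detE : \det E = 1.
  rewrite /E det_one_add_mulmx -rowE.
  have -> : row r u = 0 by apply/matrixP => i j; rewrite !mxE (negPf rX).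
  by rewrite addr0 det1.
have -> : minor A (r |: X) f = \det (E *m padded A (r |: X) f).
  by rewrite det_mulmx detE mul1r.
rewrite mulmxDl mul1mx -mulmxA -rowE.
have uE i j : (u *m row r (padded A (r |: X) f)) i j = u i 0 * padded A (r |: X) f r j.
  by rewrite mxE big_ord1 !mxE.
rewrite (@det_col_delta _ _ r _ (padded A' X f)).
- by rewrite mxE uE !mxE setU11 /= fr (negPf rX) mul0r addr0.
- move=> i ir; rewrite mxE uE !mxE setU11 !inE eqxx (negPf ir) /= andbT fr.
  case: ifP => iX; last by rewrite mul0r addr0.
  by rewrite mulNr divfK // subrr.
- by move=> i ir; rewrite !mxE (negPf rX) andbF (negPf ir).
- by rewrite !mxE (negPf rX) eqxx.
- move=> i j ir jr; rewrite mxE uE !mxE setU11 !inE (negPf ir) (negPf jr) /=.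
  case: (i \in X) => /=; last by rewrite mul0r addr0.
  case: (j \in X) => /=; first by rewrite A'E // mulNr.
  by rewrite (eq_sym r) (negPf jr) mulr0 addr0.
Qed.

End PrincipalMinors.

(** * Minors of the inverse of a basis *)
Section Jacobi.
Variables (R : realFieldType) (p n : nat).
Implicit Types (A : 'M[R]_(p, n)) (Y : {set 'I_p}) (f : 'I_p -> 'I_n).

(** Jacobi's identity. [Q] is [P] with [k] rows replaced by unit rows, so [Q P^-1] is the identity
    outside these rows and contains rows [g l] of [P^-1] in them. *)
Lemma det_delta_rows (k : nat) (h g : 'I_k -> 'I_p) (P Q : 'M[R]_p) : P \in unitmx -> injective h ->
  (forall l j, Q (h l) j = (g l == j)%:R) ->
  (forall i j, (forall l, h l != i) -> Q i j = P i j) ->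
  \det Q = \det P * \det (mxsub g h (invmx P)).
Proof.
move=> uP hI Qh Qi.
have -> : \det Q = \det P * \det (Q *m invmx P).
  by rewrite det_mulmx det_inv mulrC divfK // -unitfE -unitmxE.
congr (_ * _); rewrite (@det_replace_rows _ _ _ h (rowsub g (invmx P))) //.
- by congr (\det _); apply/matrixP => l l'; rewrite !mxE.
- move=> l j; rewrite !mxE (bigD1 (g l)) //= Qh eqxx mul1r big1 ?addr0 // => i il.
  by rewrite Qh eq_sym (negPf il) mul0r.
- move=> i j ih; rewrite -[RHS](mxE matrix_key (fun i j => (i == j)%:R)).
  transitivity ((P *m invmx P) i j); last by rewrite mulmxV // !mxE.
  by rewrite !mxE; apply: eq_bigr => l _; rewrite Qi.
Qed.

(** A unit row with its 1 in column [j] becomes a padding row once columns [i] and [j] are swapped;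
    this turns the matrices of Jacobi's identity into padded minors. *)
Lemma normr_det_delta_row (i j : 'I_p) (M N : 'M[R]_p) :
  (forall l, M i l = (j == l)%:R) -> (forall l, N i l = (i == l)%:R) ->
  (forall k l, k != i -> l != i -> N k l = M k (tperm i j l)) -> `|\det M| = `|\det N|.
Proof.
move=> Mi Ni NM.
have -> : `|\det M| = `|\det (xcol i j M)|.
  by rewrite xcolE det_mulmx det_perm normrM normrX normrN1 expr1n mulr1.
rewrite (@det_row_delta _ _ i _ N) ?Ni ?eqxx //.
- by rewrite !mxE Mi tpermL eqxx mul1r.
- by move=> l li; rewrite !mxE Mi; case: tpermP li => [->|->|/eqP h1 /eqP h2]; rewrite ?eqxx // ?[j == i]eq_sym => h; rewrite ?(negPf h) // eq_sym (negPf h2).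
- by move=> l li; rewrite Ni eq_sym (negPf li).
- by move=> k l ki li; rewrite NM // !mxE.
Qed.

Section Inverse.
Variables (A : 'M[R]_(p, n)) (Y : {set 'I_p}) (f : 'I_p -> 'I_n).
Hypothesis nzD : minor A Y f != 0.

(** The roles of the indices are exchanged: in [pinv j i] the index [j] stands for the basis column
    [f j] and [i] for a row of [A]. Outside [Y] it is the identity. *)
Definition pinv := invmx (padded A Y f).
Let W := pinv.
Let D := minor A Y f.

Lemma padded_unit : padded A Y f \in unitmx.
Proof. by rewrite unitmxE unitfE. Qed.

Lemma padded_pinv : padded A Y f *m W = 1%:M. Proof. exact: mulmxV padded_unit. Qed.
Lemma pinv_padded : W *m padded A Y f = 1%:M. Proof. exact: mulVmx padded_unit. Qed.

Lemma pinv_out j i : i \notin Y -> W j i = (j == i)%:R.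
Proof.
move=> iY; have /matrixP/(_ j i) := pinv_padded; rewrite !mxE => <-.
rewrite (bigD1 i) //= !mxE (negPf iY) eqxx mulr1 big1 ?addr0 // => k ki.
by rewrite !mxE (negPf iY) andbF (negPf ki) mulr0.
Qed.

Lemma pinv_out_row j i : j \notin Y -> W j i = (j == i)%:R.
Proof.
move=> jY; have /matrixP/(_ j i) := padded_pinv; rewrite !mxE => <-.
rewrite (bigD1 j) //= !mxE (negPf jY) eqxx mul1r big1 ?addr0 // => k kj.
by rewrite !mxE (negPf jY) eq_sym (negPf kj) mul0r.
Qed.

Lemma pinv_col_nz i : i \in Y -> exists2 j, j \in Y & W j i != 0.
Proof.
move=> iY; suff /existsP[j wj] : [exists j, W j i != 0].
  exists j => //; apply: contraT => jY; move: wj; rewrite pinv_out_row //.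
  case: (j =P i) => [ji|_]; last by rewrite eqxx.
  by rewrite ji iY in jY.
apply: contraT; rewrite negb_exists => /forallP e.
have /matrixP/(_ i i) := padded_pinv; rewrite !mxE eqxx big1 => [/eqP|k _].
  by rewrite eq_sym oner_eq0.
by move: (e k); rewrite negbK => /eqP ->; rewrite mulr0.
Qed.

Lemma pinv_row_nz j : j \in Y -> exists2 i, i \in Y & W j i != 0.
Proof.
move=> jY; suff /existsP[i wi] : [exists i, W j i != 0].
  exists i => //; apply: contraT => iY; move: wi; rewrite pinv_out //.
  case: (j =P i) => [ji|_]; last by rewrite eqxx.
  by rewrite -ji jY in iY.
apply: contraT; rewrite negb_exists => /forallP e.
have /matrixP/(_ j j) := pinv_padded; rewrite !mxE eqxx big1 => [/eqP|k _].
  by rewrite eq_sym oner_eq0.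
by move: (e k); rewrite negbK => /eqP ->; rewrite mul0r.
Qed.

Lemma pinv_rows_indep (j j' : 'I_p) (a b : R) : j != j' ->
  (forall i, a * W j i = b * W j' i) -> a = 0 /\ b = 0.
Proof.
move=> jj e.
have s k : a * (j == k)%:R = b * (j' == k)%:R.
  have /matrixP w := pinv_padded; move: (w j k) (w j' k); rewrite !mxE => <- <-.
  by rewrite !mulr_sumr; apply: eq_bigr => i _; rewrite !mulrA e.
by move: (s j) (s j'); rewrite !eqxx (negPf jj) (eq_sym j') (negPf jj) !mulr1 !mulr0.
Qed.

Lemma pinv_cols_indep (i i' : 'I_p) (a b : R) : i != i' ->
  (forall j, a * W j i = b * W j i') -> a = 0 /\ b = 0.
Proof.
move=> ii e.
have s k : a * (k == i)%:R = b * (k == i')%:R.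
  have /matrixP w := padded_pinv; move: (w k i) (w k i'); rewrite !mxE => <- <-.
  by rewrite !mulr_sumr; apply: eq_bigr => j _; rewrite !(mulrCA _ (padded _ _ _ _ _)) e.
by move: (s i) (s i'); rewrite !eqxx (negPf ii) (eq_sym i') (negPf ii) !mulr1 !mulr0.
Qed.

(** Cramer's rule: coordinate [j] of column [c] in the basis is the effect of exchanging the column
    of [j] for [c]. *)
Lemma pinv_mul_col j c : j \in Y ->
  \sum_(i in Y) W j i * A i c = minor A Y (fun k => if k == j then c else f k) / D.
Proof.
move=> jY; set f' := (fun k => if k == j then c else f k).
apply: (mulIf nzD); rewrite divfK //.
have Wl i l : l != j -> (W *m padded A Y f') i l = (i == l)%:R.
  move=> lj; have /matrixP/(_ i l) := pinv_padded; rewrite !mxE => <-.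
  by apply: eq_bigr => k _; rewrite !mxE /f' (negPf lj).
have e : \det (W *m padded A Y f') = \sum_(i in Y) W j i * A i c.
  rewrite (@det_row_delta _ _ j _ 1%:M) ?det1 ?mulr1.
  - rewrite mxE (bigID (mem Y)) /= addrC big1 ?add0r => [|i iY].
      by apply: eq_bigr => i iY; rewrite mxE iY jY /f' eqxx.
    rewrite mxE (negPf iY) /=; case: eqP => [ij|_]; last by rewrite mulr0.
    by rewrite ij jY in iY.
  - by move=> l lj; rewrite Wl // eq_sym (negPf lj).
  - by move=> l lj; rewrite mxE eq_sym (negPf lj).
  - by rewrite mxE eqxx.
  - by move=> i l _ lj; rewrite Wl // mxE.
by rewrite -e det_mulmx /W /pinv det_inv mulrAC mulVr ?mul1r // unitfE.
Qed.

Lemma normr_pinv i j : i \in Y -> j \in Y ->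
  `|W j i| = `|minor A (Y :\ i) (f \o tperm i j)| / `|D|.
Proof.
move=> iY jY.
pose Q : 'M[R]_p := \matrix_(k, l) if k == i then (j == l)%:R else padded A Y f k l.
have dQ : \det Q = D * W j i.
  rewrite (@det_delta_rows 1 (fun=> i) (fun=> j) (padded A Y f) _ padded_unit).
  - by congr (_ * _); rewrite det_mx11 !mxE.
  - by move=> x y _; rewrite (ord1 x) (ord1 y).
  - by move=> l k; rewrite mxE eqxx.
  - by move=> k l /(_ ord0); rewrite mxE eq_sym => /negPf ->.
apply: (mulIf (x := `|D|)); first by rewrite normr_eq0.
rewrite divfK ?normr_eq0 // mulrC -normrM -dQ.
rewrite (@normr_det_delta_row i j Q (padded A (Y :\ i) (f \o tperm i j))) //.
- by move=> l; rewrite mxE eqxx.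
- by move=> l; rewrite mxE !inE eqxx.
- move=> k l ki li; rewrite !mxE (negPf ki) !inE ki li /=.
  have -> : (tperm i j l \in Y) = (l \in Y) by case: tpermP => [->|->|]; rewrite ?iY ?jY.
  case: ifP => // /negbT; rewrite negb_and; case: tpermP => // [l'|l' lY]; subst l.
    by rewrite eqxx in li.
  by case: (eqVneq k j) lY => [->|kj]; rewrite jY ?orbF // (negPf ki).
Qed.

Lemma normr_pinv2 i i' j j' : i \in Y -> i' \in Y -> j \in Y -> j' \in Y -> i != i' -> j != j' ->
  exists g, `|W j i * W j' i' - W j i' * W j' i| = `|minor A (Y :\ i :\ i') g| / `|D|.
Proof.
move=> iY i'Y jY j'Y ii jj.
pose Q : 'M[R]_p := \matrix_(k, l)
  if k == i then (j == l)%:R else if k == i' then (j' == l)%:R else padded A Y f k l.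
(* After the first swap the 1 of the second unit row sits at position [s1 j']; this is the position
   that the second swap must bring to [i']. *)
pose s1 := tperm i j; pose j2 := s1 j'; pose s2 := tperm i' j2.
have s1Y k : (s1 k \in Y) = (k \in Y) by rewrite /s1; case: tpermP => [->|->|]; rewrite ?iY ?jY.
have j2Y : j2 \in Y by rewrite s1Y.
have j2i : j2 != i by rewrite -[X in _ != X](tpermR i j) (inj_eq perm_inj) eq_sym.
have s2i : s2 i = i by rewrite /s2 tpermD // eq_sym.
have s2Y k : (s2 k \in Y) = (k \in Y) by rewrite /s2; case: tpermP => [->|->|]; rewrite ?i'Y ?j2Y.
exists (f \o s1 \o s2).
have dQ : \det Q = D * (W j i * W j' i' - W j i' * W j' i).
  rewrite (@det_delta_rows 2 (fun l => if l == ord0 then i else i')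
     (fun l => if l == ord0 then j else j') (padded A Y f) _ padded_unit).
  - congr (_ * _); rewrite (expand_det_row _ ord0) !big_ord_recl big_ord0 addr0.
    by rewrite /cofactor !det_mx11 !mxE /= /bump /= /W /pinv; ring.
  - move=> x y; case: (altP (x =P ord0)) => [->|x0]; case: (altP (y =P ord0)) => [->|y0] // e.
    + by rewrite e eqxx in ii.
    + by rewrite e eqxx in ii.
    + by apply: val_inj; case: x y x0 y0 {e} => [[|[|]]] // ? [[|[|]]].
  - by move=> l k; rewrite !mxE; case: (l == ord0); rewrite ?eqxx // (eq_sym i') (negPf ii).
  - move=> k l e; rewrite !mxE; move: (e ord0) (e ord_max) => /=.
    by rewrite ![_ == k]eq_sym => /negPf -> /negPf ->.
apply: (mulIf (x := `|D|)); first by rewrite normr_eq0.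
rewrite divfK ?normr_eq0 // mulrC -normrM -dQ.
pose N1 : 'M[R]_p := \matrix_(k, l)
  if k == i' then (j2 == l)%:R else padded A (Y :\ i) (f \o s1) k l.
rewrite (@normr_det_delta_row i j Q N1).
- rewrite (@normr_det_delta_row i' j2 N1 (padded A (Y :\ i :\ i') (f \o s1 \o s2))) //.
  + by move=> l; rewrite mxE eqxx.
  + by move=> l; rewrite mxE !inE eqxx.
  + move=> k l ki li; rewrite !mxE (negPf ki) !inE ki li s2Y /=.
    have -> : (s2 l == i) = (l == i) by rewrite -[X in _ == X]s2i (inj_eq perm_inj).
    case: ifP => // /negbT; rewrite /s2; case: tpermP => // [l'|l' lY]; subst l; first by rewrite eqxx in li.
    rewrite j2i j2Y /= !andbT in lY.
    rewrite (negPf ki); case: eqP => // kj; subst k.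
    by rewrite j2i j2Y in lY.
- by move=> l; rewrite mxE eqxx.
- by move=> l; rewrite !mxE (negPf ii) !inE eqxx.
- move=> k l ki li; rewrite !mxE (negPf ki) !inE ki li /= s1Y.
  case: ifP => [/eqP ?|ki'].
    subst k; rewrite -[j2 == l](inj_eq (@perm_inj _ s1)) /j2 /s1 tpermK //.
  case: ifP => // /negbT; rewrite /s1; case: tpermP => // [l'|l' lY]; subst l.
    by rewrite eqxx in li.
  by case: (eqVneq k j) lY => [->|kj]; rewrite jY ?orbF // (negPf ki).
Qed.

End Inverse.
End Jacobi.

(** * Adding rows to an interlace *)
Section EqualMinors.
Variables (R : realFieldType) (p n : nat).
Implicit Types (A : 'M[R]_(p, n)) (X Y Z I : {set 'I_p}) (f g : 'I_p -> 'I_n).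

(** Without nonzero minors this holds for every [d]; the existence of a nonzero minor is tracked
    separately, by [nzminor]. The columns [f] need be neither increasing nor distinct, as only
    absolute values of nonzero minors count. *)
Definition eqminor A Y (d : R) := forall f, minor A Y f != 0 -> `|minor A Y f| = d.

Lemma eqminor_zero_cols A A' Y d (z : pred 'I_n) :
  (forall i c, i \in Y -> A' i c = if z c then 0 else A i c) -> eqminor A Y d -> eqminor A' Y d.
Proof.
move=> A'E eA f; have [/existsP[j /andP[jY zj]]|/existsPn nz] := boolP [exists j, (j \in Y) && z (f j)].
  by rewrite (minor_zero_col jY) ?eqxx // => i iY; rewrite A'E // zj.
suff -> : minor A' Y f = minor A Y f by apply: eA.
apply: eq_minor => i j iY jY; rewrite A'E //.
by have := nz j; rewrite jY /= => /negPf ->.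
Qed.

Lemma eqminor_pivot A A' X r b d : r \notin X -> A r b != 0 ->
  (forall i c, i != r -> A' i c = A i c - A i b / A r b * A r c) ->
  eqminor A (r |: X) d -> eqminor A' X (d / `|A r b|).
Proof.
move=> rX Arb A'E eA f nz.
pose g k := if k == r then b else f k.
have gf : minor A' X f = minor A' X g.
  apply: eq_minor => i j _ jX; rewrite /g; case: eqP => // jr.
  by rewrite -jr jX in rX.
have gE : minor A (r |: X) g = A r b * minor A' X g.
  by apply: pivot_minor => //; rewrite /g eqxx.
rewrite gf in nz *; rewrite -(eA g) gE ?mulf_neq0 //.
by rewrite normrM mulrAC mulfV ?mul1r // normr_eq0.
Qed.

Lemma sign_cases (x : R) : x \in [:: 0; 1; -1] -> x != 0 -> x = 1 \/ x = -1.
Proof. by rewrite !inE => /or3P[] /eqP ->; rewrite ?eqxx; [|left|right]. Qed.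

(* Pivoting on a row r of X leaves a system of the same kind: by the hypothesis
   on {a, r}, either the rows in I are unchanged, or exactly their entries on
   the support of r become zero. *)
Lemma eqminor_join A I X (e : {set 'I_p} -> R) eI : [disjoint I & X] ->
  (forall i c, i \in I -> A i c \in [:: 0; 1; -1]) ->
  (forall i i' c, i \in I -> i' \in I -> A i c = 0 -> A i' c = 0) ->
  (forall Z, Z \subset X -> eqminor A Z (e Z)) ->
  (forall i Z, i \in I -> Z \subset X -> eqminor A (i |: Z) (e Z)) ->
  eqminor A I eI -> eqminor A (I :|: X) (eI * e X).
Proof.
have [m] := ubnP #|X|; elim: m => // m IH in A X e *; rewrite ltnS => Xm dIX I01 Is eX eIX eI0.
move=> f; have [X0|[r rX]] := set_0Vmem X.
  have := eX set0 (sub0set _) f; rewrite X0 minor0 oner_eq0 normr1 => <- //.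
  by rewrite mulr1 setU0; apply: eI0.
set Y := I :|: X => nzf.
have rY : r \in Y by rewrite inE rX orbT.
(* Columns outside the minor are set to zero, so that every nonzero entry of row [r] lies in a
   column of the minor and can serve as pivot. *)
pose z c := c \notin [set f j | j in Y].
pose A1 := \matrix_(i, c) if z c then 0 else A i c.
have A1E i c : A1 i c = if z c then 0 else A i c by rewrite mxE.
have zf j : j \in Y -> z (f j) = false by move=> jY; rewrite /z imset_f.
have e1 Z d : eqminor A Z d -> eqminor A1 Z d by apply: eqminor_zero_cols => i c _; apply: A1E.
have A1f : minor A1 Y f = minor A Y f by apply: eq_minor => i j iY jY; rewrite A1E zf.
rewrite -A1f in nzf *.
have I01' i c : i \in I -> A1 i c \in [:: 0; 1; -1].
  by move=> iI; rewrite A1E; case: ifP => _; [rewrite inE eqxx|apply: I01].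
have Is' i i' c : i \in I -> i' \in I -> A1 i c = 0 -> A1 i' c = 0.
  by move=> iI i'I; rewrite !A1E; case: ifP => // _; apply: Is.
(* The rows of [I] share their zeros. So either some column of the minor is nonzero in row [r] and
   zero on [I], or every row of [I] is nonzero wherever row [r] is. *)
have [j0 [j0Y rj0 alt]] : exists j, [/\ j \in Y, A1 r (f j) != 0 &
    (forall i, i \in I -> A1 i (f j) = 0) \/
    (forall i c, i \in I -> A1 r c != 0 -> A1 i c != 0)].
  pose q j := [&& j \in Y, A1 r (f j) != 0 & [forall i in I, A1 i (f j) == 0]].
  have [/existsP[j /and3P[jY rj /forall_inP h]]|/existsPn nq] := boolP [exists j, q j].
    by exists j; split=> //; left=> i /h/eqP.
  have [j jY rj] : exists2 j, j \in Y & A1 r (f j) != 0.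
    apply/exists_inP; apply: contraNT nzf; rewrite negb_exists_in => /forall_inP h.
    by rewrite (minor_zero_row rY) // => j /h; rewrite negbK => /eqP.
  exists j; split=> //; right=> i c iI rc.
  have /imsetP[j' j'Y cj] : c \in [set f j | j in Y].
    by apply: contraNT rc => zc; rewrite A1E /z zc.
  subst c; apply: contra (nq j') => /eqP ic; rewrite /q j'Y rc /=.
  by apply/forall_inP => i' i'I; apply/eqP/(Is' i).
set b := f j0 in rj0 alt.
pose A' := \matrix_(i, c) (A1 i c - A1 i b / A1 r b * A1 r c).
have A'E i c : A' i c = A1 i c - A1 i b / A1 r b * A1 r c by rewrite mxE.
have YE : Y = r |: (I :|: (X :\ r)) by rewrite setUCA setD1K.
have rI : r \notin I by apply: contraL rX => rI; rewrite (disjointFr dIX).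
have rZ Z : Z \subset X :\ r -> r \notin Z by move=> /subsetP h; apply/negP => /h; rewrite !inE eqxx.
have [z' A'z] : exists z', forall i c, i \in I -> A' i c = if z' c then 0 else A1 i c.
  case: alt => [alt|alt].
    by exists pred0 => i c iI; rewrite A'E alt // mul0r mul0r subr0.
  exists (fun c => A1 r c != 0) => i c iI; rewrite A'E.
  case: eqP => [->|/eqP rc] /=; first by rewrite mulr0 subr0.
  have ib := alt _ _ iI rj0; have ic := alt _ _ iI rc.
  have er c' : A1 r c' != 0 -> `|A1 r c'| = e [set r].
    move=> nz; have := e1 _ _ (eX [set r] _) (fun=> c'); rewrite minor1 sub1set; exact.
  (* The pivoted entry is a difference of two signs, hence 0 or [2] in absolute value, while the
     equideterminant of [{i, r}] allows only 0 or 1. *)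
  apply/eqP; apply: contraT => nz.
  have ri : r \notin [set i] by rewrite inE; apply: contraNneq rI => ->.
  have := eqminor_pivot ri rj0 (fun i c _ => A'E i c) (d := e [set r]).
  rewrite setUC => /(_ (e1 _ _ (eIX i [set r] iI _)) (fun=> c)).
  rewrite minor1 A'E sub1set => /(_ rX nz).
  rewrite -(er _ rj0) mulfV ?normr_eq0 //.
  have : A1 r c / A1 r b = 1 \/ A1 r c / A1 r b = -1.
    have : `|A1 r c / A1 r b| = 1 by rewrite normrM normfV !er // mulfV // -(er _ rj0) normr_eq0.
    by case: (ger0P (_ / _)) => _ h; [left|right]; rewrite -?h ?opprK.
  move=> q1 n1; move: nz n1; rewrite (mulrAC _ _ (A1 r c)) -(mulrA _ (A1 r c)).
  by case: q1 => ->; case: (sign_cases (I01' _ _ iI) ib) => ->;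
     case: (sign_cases (I01' _ _ iI) ic) => ->; case: (ger0P (_ - _)); lra.
pose f' := f \o tperm r j0.
have f'r : f' r = b by rewrite /f' /= tpermL.
have rIX : r \notin I :|: X :\ r by rewrite !inE eqxx (negPf rI).
have nf : `|minor A1 Y f| = `|minor A1 Y f'| by rewrite minor_tperm.
rewrite nf; move: nzf; rewrite -normr_eq0 nf normr_eq0.
rewrite YE (pivot_minor rIX rj0 f'r (fun i c _ => A'E i c)) mulf_eq0 negb_or rj0 normrM /= => nz'.
(* Pivoting divides each equideterminant by the absolute value of the pivot, which gives the weights
   of the smaller system. *)
rewrite (IH A' (X :\ r) (fun Z => e (r |: Z) / `|A1 r b|)) //.
- by rewrite setD1K // mulrC -mulrA divfK // normr_eq0.
- by move: Xm; rewrite (cardsD1 r) rX.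
- by apply: disjointWr dIX; apply: subD1set.
- by move=> i c iI; rewrite A'z //; case: ifP => _; [rewrite inE eqxx|apply: I01'].
- by move=> i i' c iI i'I; rewrite !A'z //; case: ifP => // _; apply: Is'.
- move=> Z ZX; apply: eqminor_pivot (rZ _ ZX) rj0 (fun i c _ => A'E i c) _.
  by apply/e1/eX; rewrite -(setD1K rX) setUS.
- move=> i Z iI ZX; apply: eqminor_pivot _ rj0 (fun i c _ => A'E i c) _.
    by rewrite !inE negb_or (rZ _ ZX) andbT; apply: contraNneq rI => ->.
  rewrite setUCA; apply/e1/eIX => //; rewrite -(setD1K rX) setUS //.
- by apply: (eqminor_zero_cols (z := z') _ (e1 _ _ eI0)).
Qed.

End EqualMinors.

(** * The gap of equideterminants *)
Section Gap.
Variables (R : realFieldType) (p n : nat) (A : 'M[R]_(p, n)).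
Implicit Types (X Y Z : {set 'I_p}) (f g : 'I_p -> 'I_n).
Local Notation W Y f := (pinv A Y f).

Lemma normr_pinv_eq Y f i j a : minor A Y f != 0 -> i \in Y -> eqminor A (Y :\ i) a ->
  j \in Y -> W Y f j i != 0 -> `|W Y f j i| = a / `|minor A Y f|.
Proof.
move=> nz iY ea jY; rewrite -normr_eq0 normr_pinv // mulf_eq0 negb_or normr_eq0.
by case/andP => nz' _; rewrite ea.
Qed.

Lemma eqminor_gt0 Y f i a : minor A Y f != 0 -> i \in Y -> eqminor A (Y :\ i) a -> 0 < a.
Proof.
move=> nz iY ea; have [j jY wj] := pinv_col_nz nz iY.
have := normr_pinv_eq nz iY ea jY wj; have : 0 < `|W Y f j i| by rewrite normr_gt0.
by move=> h e; move: h; rewrite e pmulr_lgt0 // invr_gt0 normr_gt0.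
Qed.

Lemma normr_sub_cases (x y m : R) : 0 < m -> (x != 0 -> `|x| = m) -> (y != 0 -> `|y| = m) ->
  x != y -> (`|x - y| = m /\ (x = 0 \/ y = 0)) \/ (`|x - y| = 2 * m /\ x != 0 /\ y != 0).
Proof.
move=> m0; have [->|x0] := eqVneq x 0; have [->|y0] := eqVneq y 0.
- by [].
- by move=> _ /(_ isT) ym _; left; rewrite sub0r normrN; split; [|left].
- by move=> /(_ isT) xm _ _; left; rewrite subr0; split; [|right].
move=> /(_ isT) xm /(_ isT) ym xy; right; split=> //.
move: xm ym xy; case: (ger0P x); case: (ger0P y) => ? ? xm ym /eqP xy.
- by case: xy; rewrite xm ym.
- by case: (ger0P (x - y)); lra.
- by case: (ger0P (x - y)); lra.
- by case: xy; lra.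
Qed.

(* The 2x2 minors of the inverse in columns i, i' are 0 or c/d, while their two
   terms are 0 or +-(a/d)(b/d). *)
Lemma minor_gap Y f i i' a b c : minor A Y f != 0 -> i \in Y -> i' \in Y -> i != i' ->
  eqminor A (Y :\ i) a -> eqminor A (Y :\ i') b -> eqminor A (Y :\ i :\ i') c ->
  (`|minor A Y f| * c = a * b /\
   forall j j', j \in Y -> j' \in Y -> W Y f j i != 0 -> W Y f j i' != 0 ->
     W Y f j' i != 0 -> W Y f j' i' != 0 -> W Y f j i * W Y f j' i' = W Y f j i' * W Y f j' i) \/
  (`|minor A Y f| * c = 2 * (a * b) /\
   forall j, j \in Y -> (W Y f j i == 0) = (W Y f j i' == 0)).
Proof.
move=> nz iY i'Y ii ea eb ec.
set w := W Y f; set d := `|minor A Y f|.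
have d0 : 0 < d by rewrite normr_gt0.
have a0 := eqminor_gt0 nz iY ea; have b0 := eqminor_gt0 nz i'Y eb.
pose m := a / d * (b / d).
have m0 : 0 < m by rewrite !mulr_gt0 // invr_gt0.
have wi j : j \in Y -> w j i != 0 -> `|w j i| = a / d by exact: normr_pinv_eq.
have wi' j : j \in Y -> w j i' != 0 -> `|w j i'| = b / d by exact: normr_pinv_eq.
have prod1 j j' : j \in Y -> j' \in Y -> w j i * w j' i' != 0 -> `|w j i * w j' i'| = m.
  by move=> jY j'Y; rewrite mulf_eq0 negb_or normrM => /andP[/wi -> // /wi' -> //].
have prod2 j j' : j \in Y -> j' \in Y -> w j i' * w j' i != 0 -> `|w j i' * w j' i| = m.
  by move=> jY j'Y; rewrite mulrC; apply: prod1.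
have two j j' : j \in Y -> j' \in Y -> w j i * w j' i' != w j i' * w j' i ->
    `|w j i * w j' i' - w j i' * w j' i| = c / d.
  move=> jY j'Y; rewrite -subr_eq0 => ne.
  have jj : j != j' by apply: contraNneq ne => ->; rewrite mulrC subrr.
  have [g hg] := normr_pinv2 nz iY i'Y jY j'Y ii jj.
  move: ne; rewrite -normr_eq0 -/w hg mulf_eq0 negb_or normr_eq0.
  by case/andP => nz' _; rewrite ec.
(* Columns [i] and [i'] of an inverse are independent, so some 2x2 minor in them is nonzero. Its
   size decides between the two cases for all rows. *)
have [j [j' [jY j'Y ne]]] : exists j j', [/\ j \in Y, j' \in Y & w j i * w j' i' != w j i' * w j' i].
  have [j0 j0Y wj0] := pinv_col_nz nz iY.
  have [/exists_inP[j jY ne]|] := boolP [exists j in Y, w j i * w j0 i' != w j i' * w j0 i].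
    by exists j, j0.
  rewrite negb_exists_in => /forall_inP h.
  have [|_ /eqP] := @pinv_cols_indep _ _ _ _ _ _ nz i i' (w j0 i') (w j0 i) ii; last by rewrite (negPf wj0).
  move=> j; have [jY|jY] := boolP (j \in Y).
    by rewrite mulrC (mulrC (w j0 i)); apply/eqP; move: (h _ jY); rewrite negbK.
  have out k : k \in Y -> w j k = 0.
    move=> kY; have := pinv_out_row nz k jY; rewrite -/w => ->.
    by rewrite (_ : (j == k) = false) //; apply: contraNF jY => /eqP ->.
  by rewrite !out // !mulr0.
have fin k : c / d = k * m -> d * c = k * (a * b).
  move=> e; apply: (mulIf (x := d^-1 * d^-1)); first by rewrite mulf_neq0 // invr_eq0 gt_eqF.
  by rewrite mulrACA mulfV ?gt_eqF // mul1r e -[RHS]mulrA /m (mulrACA a).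
(* All nonzero 2x2 minors have the absolute value [c / d]. If it is [m], a minor with four nonzero
   entries would have to be [2 m], so it vanishes. *)
case: (normr_sub_cases m0 (prod1 _ _ jY j'Y) (prod2 _ _ jY j'Y) ne); rewrite two // => -[cm _].
  left; split=> [|k k' kY k'Y n1 n2 n3 n4]; first by rewrite (fin 1) ?mul1r.
  apply/eqP; apply: contraT => nk.
  case: (normr_sub_cases m0 (prod1 _ _ kY k'Y) (prod2 _ _ kY k'Y) nk); rewrite two //; last by lra.
  by case=> _ [] /eqP; rewrite mulf_eq0 ?(negPf n1) ?(negPf n4) ?(negPf n2) ?(negPf n3).
right; split=> [|k kY]; first exact: fin.
(* When the common value is [2 m], a row with a zero in one of the two columns makes a product
   vanish, so all its 2x2 minors vanish; this forces its other entry to be zero too. *)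
have only k1 k2 : k1 \in Y -> k2 \in Y -> w k1 i = 0 \/ w k1 i' = 0 -> w k1 i * w k2 i' = w k1 i' * w k2 i.
  move=> k1Y k2Y z; apply/eqP; apply: contraT => nk.
  case: (normr_sub_cases m0 (prod1 _ _ k1Y k2Y) (prod2 _ _ k1Y k2Y) nk); rewrite two //; first by lra.
  by case=> _ []; case: z => ->; rewrite mul0r eqxx.
apply/eqP/eqP => z.
  have [k2 k2Y wk2] := pinv_col_nz nz iY.
  have /esym/eqP := only k k2 kY k2Y (or_introl z).
  by rewrite z mul0r mulf_eq0 (negPf wk2) orbF => /eqP.
have [k2 k2Y wk2] := pinv_col_nz nz i'Y.
have /eqP := only k k2 kY k2Y (or_intror z).
by rewrite z mul0r mulf_eq0 (negPf wk2) orbF => /eqP.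
Qed.

Definition nzminor Y := exists f, minor A Y f != 0.

Lemma nzminor_sub X Y : X \subset Y -> nzminor Y -> nzminor X.
Proof.
have [m] := ubnP #|Y|; elim: m => // m IH in Y *; rewrite ltnS => Ym XY [f nz].
have [->|] := eqVneq X Y; first by exists f.
rewrite eqEsubset XY /= => /subsetPn[i iY iX].
apply: (IH (Y :\ i)).
- by rewrite (cardsD1 i) iY in Ym.
- by rewrite subsetD1 XY.
have [j jY wj] := pinv_col_nz nz iY; exists (f \o tperm i j).
by move: wj; rewrite -normr_eq0 normr_pinv // mulf_eq0 negb_or normr_eq0 => /andP[].
Qed.

End Gap.

Lemma int_of_01 (R : archiRealFieldType) (x : R) : x \in [:: 0; 1; -1] -> x \is a Num.int.
Proof. by rewrite !inE => /or3P[] /eqP ->; rewrite ?rpredN ?rpred1 ?rpred0. Qed.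

(** * Equideterminants as powers of two, and their exponents *)

Section PowersOfTwo.
Variables (R : archiRealFieldType) (p n : nat) (A : 'M[R]_(p, n)).
Hypothesis A01 : forall i c, A i c \in [:: 0; 1; -1].
Implicit Types (X Y Z G : {set 'I_p}) (f g : 'I_p -> 'I_n).
Local Notation W Y f := (pinv A Y f).

Lemma int01 i c : A i c \is a Num.int.
Proof. exact: int_of_01. Qed.

(** Multiply the diagonal entry [1] of [padded * pinv] at [i] by [D / a]: the entries of column [i]
    of the inverse become 0 or a sign, and those of [A] are integers, so [D / a] is an integer. *)
Lemma minor_multiple Y f i a : minor A Y f != 0 -> i \in Y -> eqminor A (Y :\ i) a ->
  exists k : nat, `|minor A Y f| = k%:R * a.
Proof.
move=> nz iY ea; have a0 := eqminor_gt0 nz iY ea.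
set D := minor A Y f in nz *; set w := W Y f.
suff /intrP[z zE] : D / a \is a Num.int.
  exists `|z|%N; rewrite -[D](divfK (lt0r_neq0 a0)) zE normrM (gtr0_norm a0).
  by rewrite natr_absz intr_norm.
have /matrixP/(_ i i) := padded_pinv nz; rewrite !mxE eqxx => e.
rewrite -[D]mul1r -[1]e mulr_suml mulr_suml rpred_sum // => j _.
rewrite mxE iY /=; case: ifP => jY; last first.
  rewrite (_ : (i == j) = false) ?mul0r ?mul0r ?rpred0 //.
  by apply: contraFF jY => /eqP <-.
rewrite -!mulrA rpredM ?int01 //.
have [->|wj] := eqVneq (pinv A Y f j i) 0; first by rewrite mul0r rpred0.
have : `|pinv A Y f j i * (D / a)| = 1.
  rewrite normrM (normr_pinv_eq nz iY ea jY wj) normrM normfV (gtr0_norm a0) -/D.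
  by rewrite mulrA divfK ?normr_eq0 // divff // lt0r_neq0.
case: (ger0P (_ * _)) => _; first by move=> ->; rewrite rpred1.
by move=> /eqP; rewrite eqr_oppLR => /eqP ->; rewrite rpredN rpred1.
Qed.

Definition pow2 k : R := 2 ^+ k.

Lemma pow2_gt0 k : 0 < pow2 k. Proof. exact: exprn_gt0. Qed.

Lemma pow2D k l : pow2 (k + l) = pow2 k * pow2 l. Proof. exact: exprD. Qed.

Lemma pow2S k : pow2 k.+1 = 2 * pow2 k. Proof. exact: exprS. Qed.

Lemma pow2_inj : injective pow2.
Proof. by move=> k l; apply: ieexprIn; rewrite ?ltr0n // eq_sym lt_eqF // ltr1n. Qed.

Lemma exp_mono Y f i k l : minor A Y f != 0 -> i \in Y -> eqminor A (Y :\ i) (pow2 k) ->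
  eqminor A Y (pow2 l) -> (k <= l)%N.
Proof.
move=> nz iY ek el; have [q] := minor_multiple nz iY ek.
rewrite (el _ nz) /pow2 -!natrX -natrM => /eqP; rewrite eqr_nat => /eqP lE.
have q0 : (0 < q)%N by case: q lE => // /eqP; rewrite mul0n expn_eq0.
by rewrite -(@leq_exp2l 2) // lE leq_pmull.
Qed.

Lemma gap_exp Y f i i' a b c : minor A Y f != 0 -> i \in Y -> i' \in Y -> i != i' ->
  eqminor A (Y :\ i) (pow2 a) -> eqminor A (Y :\ i') (pow2 b) -> eqminor A (Y :\ i :\ i') (pow2 c) ->
  `|minor A Y f| * pow2 c = pow2 (a + b) \/ `|minor A Y f| * pow2 c = pow2 (a + b).+1.
Proof.
move=> nz iY i'Y ii ea eb ec; rewrite pow2S pow2D.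
by case: (minor_gap nz iY i'Y ii ea eb ec) => -[e _]; [left|right].
Qed.

(** By induction the sets with one or two rows removed have exponents [a], [b], [c], and the gap
    identity gives the minor the exponent [a + b - c] or one more. Divisibility of minors yields
    [c <= a], so the exponent is a natural number. *)
Lemma te_pow2_exists Y : nzminor A Y -> (forall Z, Z \subset Y -> exists d, eqminor A Z d) ->
  exists e : nat, eqminor A Y (pow2 e).
Proof.
have [m] := ubnP #|Y|; elim: m => // m IH in Y *; rewrite ltnS => Ym [f nz] te.
have IH1 Z i : Z \subset Y -> i \in Y -> i \notin Z -> exists e : nat, eqminor A Z (pow2 e).
  move=> ZY iY iZ; apply: IH.
  - apply: leq_trans Ym; rewrite (cardsD1 i Y) iY ltnS; apply: subset_leq_card.
    by rewrite subsetD1 ZY.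
  - by apply: nzminor_sub ZY _; exists f.
  - by move=> Z' Z'Z; apply: te; apply: subset_trans ZY.
have one e : `|minor A Y f| = pow2 e -> exists e : nat, eqminor A Y (pow2 e).
  have [d ed] := te Y (subxx _).
  by move=> h; exists e => g /ed ->; rewrite -h (ed _ nz).
have [Y0|[i iY]] := set_0Vmem Y.
  by apply: (one 0%N); rewrite Y0 minor0 normr1.
have [Y1|[i' i'Y]] := set_0Vmem (Y :\ i).
  have YE : Y = [set i] by rewrite -(setD1K iY) Y1 setU0.
  apply: (one 0%N); move: nz; rewrite YE minor1 => nz.
  by case: (sign_cases (A01 _ _) nz) => ->; rewrite ?normrN normr1.
have ii : i != i' by move: i'Y; rewrite !inE eq_sym => /andP[].
have i'Y' : i' \in Y by move: i'Y; rewrite inE => /andP[].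
have [a ea] := IH1 (Y :\ i) i (subD1set _ _) iY (negbT (setD11 _ _)).
have [b eb] := IH1 (Y :\ i') i' (subD1set _ _) i'Y' (negbT (setD11 _ _)).
have [c ec] : exists c : nat, eqminor A (Y :\ i :\ i') (pow2 c).
  apply: (IH1 _ i') => //; last by rewrite setD11.
  by apply: subset_trans (subD1set _ _) (subD1set _ _).
have [g gz] : nzminor A (Y :\ i) by apply: nzminor_sub (subD1set _ _) _; exists f.
have ca := exp_mono gz i'Y ec ea.
have fin k : `|minor A Y f| * pow2 c = pow2 (a + k) -> `|minor A Y f| = pow2 (a - c + k).
  move=> h; apply: (mulIf (x := pow2 c)); first by rewrite gt_eqF ?pow2_gt0.
  by rewrite h -pow2D addnAC subnK.
by case: (gap_exp nz iY i'Y' ii ea eb ec); rewrite -?addnS => /fin; apply: one.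
Qed.

Definition graded (e : {set 'I_p} -> nat) G := forall Y, Y \subset G -> eqminor A Y (pow2 (e Y)).

Lemma te_graded G : nzminor A G -> (forall Z, Z \subset G -> exists d, eqminor A Z d) ->
  exists e, graded e G.
Proof.
move=> nz te.
suff /fin_all_exists[e he] : forall Y, exists k, Y \subset G -> eqminor A Y (pow2 k) by exists e.
move=> Y.
have [YG|] := boolP (Y \subset G); last by exists 0%N.
have [|Z ZY|k ek] := @te_pow2_exists Y; first exact: nzminor_sub YG nz.
  by apply: te; apply: subset_trans YG.
by exists k.
Qed.

Section Graded.
Variables (e : {set 'I_p} -> nat) (G : {set 'I_p}).
Hypotheses (nzG : nzminor A G) (eG : graded e G).

Lemma graded_val Y f : Y \subset G -> minor A Y f != 0 -> `|minor A Y f| = pow2 (e Y).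
Proof. by move=> YG; apply: eG. Qed.

Lemma graded0 : e set0 = 0%N.
Proof.
have [f _] := nzG; apply: pow2_inj.
by rewrite -(graded_val (f := f) (sub0set _)) minor0 ?oner_eq0 // normr1.
Qed.

Lemma graded1 i : i \in G -> e [set i] = 0%N.
Proof.
move=> iG; have iG' : [set i] \subset G by rewrite sub1set.
have [f nz] := nzminor_sub iG' nzG; apply: pow2_inj.
rewrite -(graded_val iG' nz); move: nz; rewrite minor1 => nz.
by case: (sign_cases (A01 _ _) nz) => ->; rewrite ?normrN normr1.
Qed.

Lemma graded_eq0 Y : Y \subset G -> e Y = 0%N <-> eqminor A Y 1.
Proof.
move=> YG; split=> [e0 f /(graded_val YG) ->|e1]; first by rewrite e0.
have [f nz] := nzminor_sub YG nzG; apply: pow2_inj.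
by rewrite -(graded_val YG nz) e1.
Qed.

Lemma graded_mono1 Y i : Y \subset G -> (e (Y :\ i) <= e Y)%N.
Proof.
move=> YG; have [iY|iY] := boolP (i \in Y); last first.
  by rewrite (setDidPl _) // disjoint_sym disjoints1.
have [f nz] := nzminor_sub YG nzG.
apply: (exp_mono nz iY _ (eG YG)); apply: eG.
by apply: subset_trans YG; apply: subD1set.
Qed.

Lemma graded_mono X Y : X \subset Y -> Y \subset G -> (e X <= e Y)%N.
Proof.
have [m] := ubnP #|Y|; elim: m => // m IH in Y *; rewrite ltnS => Ym XY YG.
have [->//|] := eqVneq X Y.
rewrite eqEsubset XY /= => /subsetPn[i iY iX].
apply: leq_trans (graded_mono1 i YG); apply: IH.
- by rewrite (cardsD1 i) iY in Ym.
- by rewrite subsetD1 XY.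
- by apply: subset_trans YG; apply: subD1set.
Qed.

Lemma graded_pinv Y f i j : Y \subset G -> minor A Y f != 0 -> i \in Y -> j \in Y ->
  W Y f j i != 0 -> `|W Y f j i| = pow2 (e (Y :\ i)) / pow2 (e Y).
Proof.
move=> YG nz iY jY wj; rewrite -(graded_val YG nz); apply: normr_pinv_eq => //.
by apply: eG; apply: subset_trans YG; apply: subD1set.
Qed.

Lemma graded_gap Y i i' : Y \subset G -> i \in Y -> i' \in Y -> i != i' ->
  (e (Y :\ i) + e (Y :\ i') = e Y + e (Y :\ i :\ i'))%N \/
  (e (Y :\ i) + e (Y :\ i')).+1 = (e Y + e (Y :\ i :\ i'))%N.
Proof.
move=> YG iY i'Y ii; have [f nz] := nzminor_sub YG nzG.
have sub Z : Z \subset Y -> eqminor A Z (pow2 (e Z)) by move=> ZY; apply: eG; apply: subset_trans YG.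
have /sub s1 := subD1set Y i; have /sub s2 := subD1set Y i'.
have s3 := sub _ (subset_trans (subD1set (Y :\ i) i') (subD1set Y i)).
case: (gap_exp nz iY i'Y ii s1 s2 s3); rewrite (graded_val YG nz) -pow2D => /pow2_inj; [left|right] => //.
Qed.

Lemma graded_gap1 Y f i i' : Y \subset G -> minor A Y f != 0 -> i \in Y -> i' \in Y -> i != i' ->
  (e (Y :\ i) + e (Y :\ i')).+1 = (e Y + e (Y :\ i :\ i'))%N ->
  forall j, j \in Y -> (W Y f j i == 0) = (W Y f j i' == 0).
Proof.
move=> YG nz iY i'Y ii E.
have sub Z : Z \subset Y -> eqminor A Z (pow2 (e Z)) by move=> ZY; apply: eG; apply: subset_trans YG.
have /sub s1 := subD1set Y i; have /sub s2 := subD1set Y i'.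
have s3 := sub _ (subset_trans (subD1set (Y :\ i) i') (subD1set Y i)).
case: (minor_gap nz iY i'Y ii s1 s2 s3) => -[] //.
by rewrite (graded_val YG nz) -!pow2D -E => /pow2_inj; lia.
Qed.

Lemma graded_gap0 Y f i i' : Y \subset G -> minor A Y f != 0 -> i \in Y -> i' \in Y -> i != i' ->
  (e (Y :\ i) + e (Y :\ i') = e Y + e (Y :\ i :\ i'))%N ->
  forall j j', j \in Y -> j' \in Y -> W Y f j i != 0 -> W Y f j i' != 0 ->
    W Y f j' i != 0 -> W Y f j' i' != 0 -> W Y f j i * W Y f j' i' = W Y f j i' * W Y f j' i.
Proof.
move=> YG nz iY i'Y ii E.
have sub Z : Z \subset Y -> eqminor A Z (pow2 (e Z)) by move=> ZY; apply: eG; apply: subset_trans YG.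
have /sub s1 := subD1set Y i; have /sub s2 := subD1set Y i'.
have s3 := sub _ (subset_trans (subD1set (Y :\ i) i') (subD1set Y i)).
case: (minor_gap nz iY i'Y ii s1 s2 s3) => -[] //.
by rewrite (graded_val YG nz) -!pow2D -E -pow2S => /pow2_inj; lia.
Qed.

Lemma graded_pinv_col Y f j c : Y \subset G -> minor A Y f != 0 -> j \in Y ->
  \sum_(i in Y) W Y f j i * A i c \in [:: 0; 1; -1].
Proof.
move=> YG nz jY; rewrite pinv_mul_col //; set D' := minor _ _ _.
have [->|nz'] := eqVneq D' 0; first by rewrite mul0r inE eqxx.
have : `|D' / minor A Y f| = 1.
  by rewrite normrM normfV (graded_val YG nz) (graded_val YG nz') divff // gt_eqF ?pow2_gt0.
case: (ger0P (_ / _)) => _ => [->|]; first by rewrite !inE eqxx orbT.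
by move=> /eqP; rewrite eqr_oppLR => /eqP ->; rewrite !inE eqxx !orbT.
Qed.

End Graded.
End PowersOfTwo.

(** * Circuits *)
Section Circuits.
Variables (R : archiRealFieldType) (p n : nat) (A : 'M[R]_(p, n)).
Implicit Types (X Y Z C T G : {set 'I_p}) (f g : 'I_p -> 'I_n).
Local Notation W Y f := (pinv A Y f).

Definition pinv_support Y f j := [set i in Y | W Y f j i != 0].

Definition symdiff X Y := (X :\: Y) :|: (Y :\: X).

(* The common shape of the analysis modulo 2 (h = e) and modulo 4 inside an
   interlace (h = excess): [word T] means that the rows in T have a signed sum
   divisible by 2, resp. 4. *)
Record word_system G (h : {set 'I_p} -> nat) (word : {set 'I_p} -> Prop) : Prop := WordSystem {
  ws_nz : nzminor A G;
  ws0 : h set0 = 0%N;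
  ws1 : forall i, i \in G -> h [set i] = 0%N;
  ws_mono1 : forall Y i, Y \subset G -> (h (Y :\ i) <= h Y)%N;
  ws_gap : forall Y i i', Y \subset G -> i \in Y -> i' \in Y -> i != i' ->
    (h (Y :\ i) + h (Y :\ i') = h Y + h (Y :\ i :\ i'))%N \/
    (h (Y :\ i) + h (Y :\ i')).+1 = (h Y + h (Y :\ i :\ i'))%N;
  ws_gap1 : forall Y f i i', Y \subset G -> (0 < h Y)%N -> minor A Y f != 0 ->
    i \in Y -> i' \in Y -> i != i' ->
    (h (Y :\ i) + h (Y :\ i')).+1 = (h Y + h (Y :\ i :\ i'))%N ->
    forall j, j \in Y -> (W Y f j i == 0) = (W Y f j i' == 0);
  ws_gap0 : forall Y f i i', Y \subset G -> (0 < h Y)%N -> minor A Y f != 0 ->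
    i \in Y -> i' \in Y -> i != i' ->
    (h (Y :\ i) + h (Y :\ i') = h Y + h (Y :\ i :\ i'))%N ->
    forall j j', j \in Y -> j' \in Y -> W Y f j i != 0 -> W Y f j i' != 0 ->
    W Y f j' i != 0 -> W Y f j' i' != 0 -> W Y f j i * W Y f j' i' = W Y f j i' * W Y f j' i;
  ws_word_pos : forall T, T \subset G -> T != set0 -> word T -> (0 < h T)%N;
  ws_word_symdiff : forall T T', T \subset G -> T' \subset G -> word T -> word T' -> word (symdiff T T');
  ws_word_row : forall Y f j, Y \subset G -> (0 < h Y)%N -> minor A Y f != 0 -> j \in Y ->
    (forall i, i \in Y -> (h (Y :\ i)).+1 = h Y) -> word (pinv_support Y f j) }.

Variables (G : {set 'I_p}) (h : {set 'I_p} -> nat) (word : {set 'I_p} -> Prop).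
Hypothesis S : word_system G h word.

Lemma ws_minor Y : Y \subset G -> exists f, minor A Y f != 0.
Proof. by move=> YG; apply: nzminor_sub YG (ws_nz S). Qed.

Lemma ws_mono X Y : X \subset Y -> Y \subset G -> (h X <= h Y)%N.
Proof.
have [m] := ubnP #|Y|; elim: m => // m IH in Y *; rewrite ltnS => Ym XY YG.
have [->//|] := eqVneq X Y.
rewrite eqEsubset XY /= => /subsetPn[i iY iX].
apply: leq_trans (ws_mono1 S i YG); apply: IH.
- by rewrite (cardsD1 i) iY in Ym.
- by rewrite subsetD1 XY.
- by apply: subset_trans YG; apply: subD1set.
Qed.

Lemma ws_minimal k Y : Y \subset G -> (k < h Y)%N ->
  exists Z, [/\ Z \subset Y, (k < h Z)%N & forall i, i \in Z -> (h (Z :\ i) <= k)%N].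
Proof.
have [m] := ubnP #|Y|; elim: m => // m IH in Y *; rewrite ltnS => Ym YG kY.
have [/exists_inP[i iY ki]|] := boolP [exists i in Y, (k < h (Y :\ i))%N].
  have [||Z [ZY kZ minZ]] := IH (Y :\ i) _ _ ki.
  - by rewrite (cardsD1 i) iY in Ym.
  - by apply: subset_trans YG; apply: subD1set.
  by exists Z; split=> //; apply: subset_trans ZY _; apply: subD1set.
rewrite negb_exists_in => /forall_inP le; exists Y; split=> // i /le.
by rewrite -leqNgt.
Qed.

Definition circuit C := [&& C \subset G, (0 < h C)%N & [forall i in C, h (C :\ i) == 0%N]].

Lemma circuit_exists Y : Y \subset G -> (0 < h Y)%N -> exists2 C : {set _}, C \subset Y & circuit C.
Proof.
move=> YG /(ws_minimal YG)[C [CY hC minC]]; exists C => //.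
rewrite /circuit (subset_trans CY YG) hC; apply/forall_inP => i iC.
by have := minC i iC; case: (h _).
Qed.

Lemma circuit_sub C : circuit C -> C \subset G. Proof. by case/and3P. Qed.
Lemma circuit_pos C : circuit C -> (0 < h C)%N. Proof. by case/and3P. Qed.

Lemma circuit_proper C X : circuit C -> X \proper C -> h X = 0%N.
Proof.
case/and3P=> CG _ /forall_inP minC /properP[XC [i iC iX]].
apply/eqP; rewrite -leqn0 -(eqP (minC i iC)); apply: ws_mono.
  by rewrite subsetD1 XC.
by apply: subset_trans CG; apply: subD1set.
Qed.

Lemma ws_two Y i : Y \subset G -> (0 < h Y)%N -> exists2 i', i' \in Y & i' != i.
Proof.
move=> YG hY; have [Y1|[i' ]] := set_0Vmem (Y :\ i); last first.
  by rewrite !inE => /andP[]; exists i'.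
suff : h Y = 0%N by move: hY => /[swap] ->.
have [iY|iY] := boolP (i \in Y).
  by rewrite -(setD1K iY) Y1 setU0 (ws1 S) // (subsetP YG).
rewrite (_ : Y = set0) ?(ws0 S) // -Y1; apply/setP => k.
by rewrite !inE; case: eqP => // ->; apply: negPf.
Qed.

Lemma circuit_nonempty C : circuit C -> exists i, i \in C.
Proof.
case/and3P=> CG hC _; have [C0|[i]] := set_0Vmem C; last by exists i.
by rewrite C0 (ws0 S) in hC.
Qed.

(** All proper subsets have value 0, so the gap equation bounds [h C] by 1. *)
Lemma circuit_eq1 C : circuit C -> h C = 1%N.
Proof.
move=> cC; have [i iC] := circuit_nonempty cC.
case/and3P: (cC) => CG hC /forall_inP minC.
have [i' i'C ii] := ws_two i CG hC.
have := minC i iC; have := minC i' i'C.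
by case: (ws_gap S CG iC i'C _) => [||]; rewrite 1?eq_sym //; lia.
Qed.

(** [ws_gap] contains local supermodularity; the elements of [Y] outside [X] are removed one at a
    time. *)
Lemma ws_marginal X Y i : X \subset Y -> i |: Y \subset G -> i \notin Y ->
  (h (i |: X) + h Y <= h (i |: Y) + h X)%N.
Proof.
have [m] := ubnP #|Y|; elim: m => // m IH in Y *; rewrite ltnS => Ym XY iYG iY.
have [->//|] := eqVneq X Y.
rewrite eqEsubset XY /= => /subsetPn[k kY kX].
have ik : i != k by apply: contraNneq iY => ->.
have YG : Y \subset G by apply: subset_trans iYG; apply: subsetUr.
have e1 : (i |: Y) :\ i = Y by rewrite setU1K.
have e2 : (i |: Y) :\ k = i |: (Y :\ k).
  by apply/setP => l; rewrite !inE; case: (eqVneq l i) => [->|]; rewrite ?ik.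
have e3 : (i |: Y) :\ i :\ k = Y :\ k by rewrite e1.
have := ws_gap S iYG (setU11 _ _) (setU1r _ kY) ik; rewrite e3 e1 e2.
suff : (h (i |: X) + h (Y :\ k) <= h (i |: (Y :\ k)) + h X)%N by lia.
apply: IH.
- by rewrite (cardsD1 k) kY in Ym.
- by rewrite subsetD1 XY.
- by apply: subset_trans iYG; apply: setUS; apply: subD1set.
- by rewrite !inE (negPf iY) andbF.
Qed.

Lemma ws_supermodular X Y : X :|: Y \subset G -> (h X + h Y <= h (X :|: Y) + h (X :&: Y))%N.
Proof.
have [m] := ubnP #|X|; elim: m => // m IH in X *; rewrite ltnS => Xm XYG.
have [XY|] := boolP (X \subset Y).
  by rewrite (setUidPr XY) (setIidPl XY) addnC.
case/subsetPn=> i iX iY.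
have e1 : X :\ i :|: Y = (X :|: Y) :\ i.
  by apply/setP => l; rewrite !inE; case: (eqVneq l i) => [->|]; rewrite ?(negPf iY).
have e2 : (X :\ i) :&: Y = X :&: Y.
  by apply/setP => l; rewrite !inE; case: (eqVneq l i) => [->|]; rewrite ?(negPf iY) ?andbF.
have h2 : (h (X :\ i) + h Y <= h ((X :|: Y) :\ i) + h (X :&: Y))%N.
  rewrite -e1 -e2; apply: IH; first by rewrite (cardsD1 i) iX in Xm.
  by rewrite e1; apply: subset_trans XYG; apply: subD1set.
have h1 : (h X + h ((X :|: Y) :\ i) <= h (X :|: Y) + h (X :\ i))%N.
  have := @ws_marginal (X :\ i) ((X :|: Y) :\ i) i.
  rewrite (setD1K iX) setD1K ?inE ?iX //; apply=> //; last by rewrite eqxx.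
  by apply: setSD; apply: subsetUl.
by lia.
Qed.

(** Two distinct circuits intersect in a proper subset of one of them, which has value 0;
    supermodularity does the rest. *)
Lemma circuits_union C1 C2 : circuit C1 -> circuit C2 -> C1 != C2 -> (2 <= h (C1 :|: C2))%N.
Proof.
move=> c1 c2 ne.
have UG : C1 :|: C2 \subset G by rewrite subUset !circuit_sub.
have := ws_supermodular UG; rewrite (circuit_eq1 c1) (circuit_eq1 c2).
suff -> : h (C1 :&: C2) = 0%N by lia.
have [s|s] := boolP (C1 \subset C2).
  have := circuit_proper c2 (X := C1); rewrite properEneq ne s (circuit_eq1 c1).
  by move/(_ isT).
apply: (circuit_proper c1); rewrite properEneq subsetIl andbT.
by apply: contra s => /eqP/setIidPl.
Qed.

(** Every pair in a circuit has gap 1, so all columns of the inverse have the same support. Any row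
    of the inverse is then nonzero on the whole circuit, and [ws_word_row] applies to it. *)
Lemma circuit_word C : circuit C -> word C.
Proof.
move=> cC; have CG := circuit_sub cC; have hC := circuit_pos cC.
have [f nz] := ws_minor CG; have [j jC] := circuit_nonempty cC.
case/and3P: (cC) => _ _ /forall_inP minC.
have mini i : i \in C -> h (C :\ i) = 0%N by move/minC/eqP.
have mini2 i i' : i \in C -> h (C :\ i :\ i') = 0%N.
  move=> iC; apply/eqP; rewrite -leqn0 -(mini i iC); apply: (ws_mono1 S).
  by apply: subset_trans CG; apply: subD1set.
rewrite -[C](_ : pinv_support C f j = C).
  by apply: (ws_word_row S) => // i iC; rewrite mini // circuit_eq1.
apply/setP => i; rewrite inE andb_idr // => iC.
have [i0 i0C wi0] := pinv_row_nz nz jC.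
have [->//|ii] := eqVneq i i0.
by rewrite (ws_gap1 S CG hC nz iC i0C ii) // !mini // mini2 // circuit_eq1.
Qed.

Lemma symdiff_pos C1 C2 : circuit C1 -> circuit C2 -> C1 != C2 -> (0 < h (symdiff C1 C2))%N.
Proof.
move=> c1 c2 ne; have s1 := circuit_sub c1; have s2 := circuit_sub c2.
apply: (ws_word_pos S).
- by rewrite subUset !(subset_trans (subsetDl _ _) _) ?s1 ?s2.
- apply: contra ne; rewrite setU_eq0 !setD_eq0 => /andP[? ?].
  by rewrite eqEsubset; apply/andP.
by apply: (ws_word_symdiff S) => //; apply: circuit_word.
Qed.

(** * Minimal sets of value at least 2 *)

Section Minimal.
Variables (Z : {set 'I_p}).
Hypotheses (ZG : Z \subset G) (hZ : (2 <= h Z)%N) (minZ : forall i, i \in Z -> (h (Z :\ i) <= 1)%N).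

Lemma min2_proper X : X \proper Z -> (h X <= 1)%N.
Proof.
case/properP=> XZ [i iZ iX]; apply: leq_trans (minZ iZ); apply: ws_mono.
  by rewrite subsetD1 XZ.
by apply: subset_trans ZG; apply: subD1set.
Qed.

Lemma min2_union C1 C2 : circuit C1 -> circuit C2 -> C1 \subset Z -> C2 \subset Z -> C1 != C2 ->
  C1 :|: C2 = Z.
Proof.
move=> c1 c2 s1 s2 ne; have UZ : C1 :|: C2 \subset Z by rewrite subUset s1.
have [//|ne'] := eqVneq (C1 :|: C2) Z.
have := circuits_union c1 c2 ne; have := @min2_proper (C1 :|: C2).
by rewrite properEneq ne' UZ => /(_ isT); lia.
Qed.

Lemma min2_sub1 i : Z :\ i \subset G.
Proof. by apply: subset_trans ZG; apply: subD1set. Qed.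

Lemma min2_sub2 i i' : Z :\ i :\ i' \subset G.
Proof. by apply: subset_trans (min2_sub1 i); apply: subD1set. Qed.

(** Single deletions have value at most 1, so the gap equation with [h Z > 2] can only read
    [1 + 1 + 1 = 3 + 0]. *)
Lemma min2_three : (2 < h Z)%N -> forall z, z \in Z -> circuit (Z :\ z).
Proof.
move=> h3 z zZ.
have hz z' : z' \in Z -> h (Z :\ z') = 1%N /\ (forall z'', z'' \in Z -> z'' != z' -> h (Z :\ z' :\ z'') = 0%N).
  move=> z'Z; have pair z'' : z'' \in Z -> z'' != z' -> h (Z :\ z') = 1%N /\ h (Z :\ z' :\ z'') = 0%N.
    move=> z''Z ne; have := minZ z'Z; have := minZ z''Z.
    have ne' : z' != z'' by rewrite eq_sym.
    by case: (ws_gap S ZG z'Z z''Z ne'); lia.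
  split; last by move=> z'' ? ?; apply: (pair z'' _ _).2.
  have [z'' z''Z ne] := ws_two z' ZG (ltnW hZ).
  exact: (pair z'' z''Z ne).1.
rewrite /circuit min2_sub1 (hz z zZ).1 /=; apply/forall_inP => i.
by rewrite !inE => /andP[iz iZ]; rewrite (hz z zZ).2.
Qed.

(** If deleting [z0] lost both units, all circuits in [Z] would contain [z0]. The symmetric
    difference of two distinct ones avoids [z0] and still has positive value, a contradiction. *)
Lemma min2_two_del : h Z = 2%N -> forall z, z \in Z -> h (Z :\ z) = 1%N.
Proof.
move=> h2 z0 z0Z; apply/eqP; rewrite eqn_leq (minZ z0Z) lt0n /=; apply/eqP => hz0.
have inall C : circuit C -> C \subset Z -> z0 \in C.
  move=> cC CZ; apply: contraT => zC; have := circuit_pos cC.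
  have : (h C <= h (Z :\ z0))%N by apply: ws_mono; rewrite ?min2_sub1 // subsetD1 CZ.
  by rewrite hz0 leqn0 => /eqP ->.
have avoid z1 : z1 \in Z -> z1 != z0 -> exists C : {set _}, [/\ circuit C, C \subset Z, z1 \notin C & z0 \in C].
  move=> z1Z ne; have ne' : z0 != z1 by rewrite eq_sym.
  have hz1 : (0 < h (Z :\ z1))%N by case: (ws_gap S ZG z0Z z1Z ne'); rewrite hz0 h2; lia.
  have [C CZ cC] := circuit_exists (min2_sub1 z1) hz1.
  have CZ' : C \subset Z by apply: subset_trans CZ _; apply: subD1set.
  exists C; split=> //; last exact: inall.
  by apply/negP => /(subsetP CZ); rewrite !inE eqxx.
have [z1 z1Z ne1] := ws_two z0 ZG (ltnW hZ).
have [C1 [c1 C1Z _ z0C1]] := avoid z1 z1Z ne1.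
have [z2 z2C1 ne2] := ws_two z0 (circuit_sub c1) (circuit_pos c1).
have [C2 [c2 C2Z z2C2 z0C2]] := avoid z2 (subsetP C1Z _ z2C1) ne2.
have ne : C1 != C2 by apply: contraNneq z2C2 => <-.
have := symdiff_pos c1 c2 ne.
have : (h (symdiff C1 C2) <= h (Z :\ z0))%N.
  apply: ws_mono; rewrite ?min2_sub1 // subsetD1 subUset !(subset_trans (subsetDl _ _) _) //=.
  by rewrite !inE z0C1 z0C2.
by rewrite hz0 leqn0 => /eqP ->.
Qed.

Lemma pinv_support_sub Y f j : pinv_support Y f j \subset Y.
Proof. by apply/subsetP => i; rewrite inE => /andP[]. Qed.

(** A word [T] that is not a circuit contains a circuit [C], and [T :\: C] is again a nonempty word
    with a circuit [C']. Two distinct circuits inside [Z] already cover [Z]. *)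
Lemma min2_word_circuit T : T \subset Z -> T != set0 -> word T -> ~~ circuit T ->
  T = Z /\ exists P Q, [/\ circuit P, circuit Q, [disjoint P & Q] & P :|: Q = Z].
Proof.
move=> TZ T0 wT ncT; have TG := subset_trans TZ ZG.
have [C CT cC] := circuit_exists TG (ws_word_pos S TG T0 wT).
have symE : symdiff T C = T :\: C by rewrite /symdiff (_ : C :\: T = set0) ?setU0 //; apply/eqP; rewrite setD_eq0.
have sG : symdiff T C \subset G by rewrite symE (subset_trans (subsetDl _ _)).
have [//||C' C'T cC'] := @circuit_exists (symdiff T C).
  apply: (ws_word_pos S) => //; last first.
    by apply: (ws_word_symdiff S) => //; [apply: circuit_sub|apply: circuit_word].
  rewrite symE setD_eq0; apply: contra ncT => TC.
  by rewrite (_ : T = C) //; apply/eqP; rewrite eqEsubset TC.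
rewrite symE subsetD in C'T; case/andP: C'T => C'T dis.
have CC : C' :|: C = Z.
  apply: min2_union => //; try exact: subset_trans TZ.
  have [i iC] := circuit_nonempty cC.
  by apply: contraTneq dis => ->; apply/pred0Pn; exists i; rewrite /= iC.
split; last by exists C', C.
by apply/eqP; rewrite eqEsubset TZ -CC subUset C'T.
Qed.

(** In the remaining case [h Z = 2] without a splitting, the supports [T j] of the rows of the
    inverse are distinct circuits. Distinct circuits cover [Z], hence cannot miss a common element.
    Choosing one missed element for each [j] is therefore an injection of [Z] into itself, so a
    bijection, and each [T j] misses exactly one element. *)
Lemma min2_dichotomy :
  (h Z = 2%N /\ exists P Q, [/\ circuit P, circuit Q, [disjoint P & Q] & P :|: Q = Z]) \/
  (forall z, z \in Z -> circuit (Z :\ z)).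
Proof.
have [h3|] := ltnP 2 (h Z); first by right; apply: min2_three.
rewrite leq_eqVlt ltnS leqNgt hZ orbF => /eqP h2.
pose split2 := [exists P : {set 'I_p}, [exists Q : {set 'I_p},
  [&& circuit P, circuit Q, [disjoint P & Q] & P :|: Q == Z]]].
have [/existsP[P /existsP[Q /and4P[? ? ? /eqP ?]]]|nsplit] := boolP split2.
  by left; split=> //; exists P, Q.
right.
have nodis P Q : circuit P -> circuit Q -> P \subset Z -> Q \subset Z -> ~~ [disjoint P & Q].
  move=> cP cQ PZ QZ; apply: contra nsplit => d.
  apply/existsP; exists P; apply/existsP; exists Q; rewrite cP cQ d /=; apply/eqP.
  apply: min2_union => //; have [i iP] := circuit_nonempty cP.
  by apply: contraTneq d => <-; apply/pred0Pn; exists i; rewrite /= iP.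
have uni (B B' : {set 'I_p}) k : circuit B -> circuit B' -> B \subset Z -> B' \subset Z -> k \in Z ->
    k \notin B -> k \notin B' -> B = B'.
  move=> cB cB' BZ B'Z kZ kB kB'; apply/eqP; apply: contraTT kZ => ne.
  by rewrite -(min2_union cB cB' BZ B'Z ne) !inE (negPf kB).
have h1 := min2_two_del h2.
have [f nz] := ws_minor ZG.
pose T j := pinv_support Z f j.
have TZ j : T j \subset Z by apply: pinv_support_sub.
have cT j : j \in Z -> circuit (T j).
  move=> jZ; apply: contraT => ncT.
  have [||||_ [P [Q [cP cQ d PQ]]]] := @min2_word_circuit (T j) => //.
  - have [i iZ wi] := pinv_row_nz nz jZ; apply/set0Pn; exists i.
    by rewrite inE iZ.
  - by apply: (ws_word_row S) => //; [rewrite h2|move=> i iZ; rewrite h1].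
  case/negP: nsplit; apply/existsP; exists P; apply/existsP; exists Q.
  by rewrite cP cQ d PQ eqxx.
(* Equal supports would make rows [j] and [j'] of the inverse proportional. Gap 0 provides the
   proportionality for pairs of columns, and [i0], [i1] are chosen so that each column has gap 0
   with at least one of them. *)
have Tinj j j' : j \in Z -> j' \in Z -> T j = T j' -> j = j'.
  move=> jZ j'Z TT; apply/eqP; apply: contraT => jj.
  have [i0 i0T] := circuit_nonempty (cT j jZ).
  have i0Z := subsetP (TZ j) _ i0T.
  have [C0 C0Z c0] : exists2 C : {set _}, C \subset Z :\ i0 & circuit C.
    by apply: circuit_exists; [apply: min2_sub1|rewrite h1].
  have C0Z' := subset_trans C0Z (subD1set _ _).
  have /pred0Pn[i1 /= /andP[i1T i1C0]] := nodis _ _ (cT j jZ) c0 (TZ j) C0Z'.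
  have i1Z := subsetP C0Z' _ i1C0.
  have nzT i : i \in T j -> pinv A Z f j i != 0 /\ pinv A Z f j' i != 0.
    move=> iT; have : i \in T j' by rewrite -TT.
    by move: iT; rewrite !inE => /andP[_ ->] /andP[_ ->].
  have cross i i' : i \in T j -> i' \in T j -> i != i' -> h (Z :\ i :\ i') = 0%N ->
      pinv A Z f j i * pinv A Z f j' i' = pinv A Z f j i' * pinv A Z f j' i.
    move=> iT i'T ii hii; have iZ := subsetP (TZ j) _ iT; have i'Z := subsetP (TZ j) _ i'T.
    have [n1 n2] := nzT _ iT; have [n3 n4] := nzT _ i'T.
    by apply: (ws_gap0 S ZG _ nz iZ i'Z ii) => //; rewrite ?h2 // !h1 // hii.
  have apart i : i \in Z -> h (Z :\ i :\ i0) = 0%N \/ h (Z :\ i :\ i1) = 0%N.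
    move=> iZ; have [->|] := posnP (h (Z :\ i :\ i0)); first by left.
    move=> /(circuit_exists (min2_sub2 _ _))[C CZ cC].
    have [->|] := posnP (h (Z :\ i :\ i1)); first by right.
    move=> /(circuit_exists (min2_sub2 _ _))[C' C'Z cC'].
    have avoid (B : {set 'I_p}) k l : B \subset Z :\ k :\ l -> [/\ B \subset Z, k \notin B & l \notin B].
      by rewrite !subsetD1 => /andP[/andP[]].
    have [CZ' iC i0C] := avoid _ _ _ CZ.
    have [C'Z' iC' i1C'] := avoid _ _ _ C'Z.
    have i0C0 : i0 \notin C0 by apply/negP => /(subsetP C0Z); rewrite !inE eqxx.
    move: i1C'; rewrite -(uni C C' i) // (uni C C0 i0) //.
    by rewrite i1C0.
  have [n1 n2] := nzT _ i0T; have [n3 n4] := nzT _ i1T.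
  have i01 : i0 != i1 by apply: contraTneq i1C0 => <-; apply/negP => /(subsetP C0Z); rewrite !inE eqxx.
  have h01 : h (Z :\ i0 :\ i1) = 0%N.
    have := apart i0 i0Z; case=> //.
    by rewrite (_ : Z :\ i0 :\ i0 = Z :\ i0) ?h1 //; apply/setP => k; rewrite !inE andbA andbb.
  have c01 := cross _ _ i0T i1T i01 h01.
  have [|/eqP] := @pinv_rows_indep _ _ _ _ _ _ nz j j' (pinv A Z f j' i0) (pinv A Z f j i0) jj.
    move=> i; have [iZ|iZ] := boolP (i \in Z); last first.
      have nj k : k \in Z -> (k == i) = false by move=> kZ; apply: contraNF iZ => /eqP <-.
      by rewrite !(pinv_out nz _ iZ) !nj // !mulr0.
    have [iT|iT] := boolP (i \in T j); last first.
      have w0 k : i \notin T k -> pinv A Z f k i = 0.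
        by rewrite inE iZ /= negbK => /eqP.
      by rewrite !w0 ?mulr0 // -TT.
    have [->|ii0] := eqVneq i i0; first by rewrite mulrC.
    have [->|ii1] := eqVneq i i1; first by rewrite mulrC c01.
    case: (apart i iZ) => hi; first by rewrite mulrC (cross _ _ iT i0T ii0 hi).
    have ci1 := cross _ _ iT i1T ii1 hi.
    by apply: (mulIf n4); rewrite -mulrA ci1 [RHS]mulrAC c01 mulrCA mulrA.
  by rewrite (negPf n2).
move=> z zZ.
(* The default is never taken on [Z]: [T j] is a circuit of value 1, so it is not all of [Z]. *)
pose zz j := odflt j [pick k in Z :\: T j].
have zzP j : j \in Z -> zz j \in Z /\ zz j \notin T j.
  move=> jZ; rewrite /zz; case: pickP => [k|none]; first by rewrite inE => /andP[].
  have TE : T j = Z.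
    apply/eqP; rewrite eqEsubset TZ /= -setD_eq0; apply/eqP/setP => k.
    by rewrite none inE.
  by have := circuit_eq1 (cT j jZ); rewrite TE h2.
have zz_inj : {in Z &, injective zz}.
  move=> j j' jZ j'Z e; apply: Tinj => //.
  have [kZ kT] := zzP _ jZ; have [_ kT'] := zzP _ j'Z; rewrite -e in kT'.
  exact: (uni _ _ _ (cT _ jZ) (cT _ j'Z) _ _ kZ).
have zzZ k : k \in Z -> exists2 j, j \in Z & k = zz j.
  have /eqP zzE : zz @: Z == Z.
    rewrite eqEcard card_in_imset // leqnn andbT.
    by apply/subsetP => _ /imsetP[j jZ ->]; case: (zzP _ jZ).
  by rewrite -{1}zzE => /imsetP[j jZ ->]; exists j.
have [j jZ zE] := zzZ z zZ.
rewrite (_ : Z :\ z = T j) ?cT //; apply/setP => k; rewrite in_setD1 zE.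
apply/andP/idP => [[kz kZ]|kT]; last first.
  split; last exact: (subsetP (TZ j)).
  by apply: contraTneq kT => ->; case: (zzP _ jZ).
have [j' j'Z kE] := zzZ k kZ.
have ne : T j != T j' by apply: contraNneq kz => /Tinj jj; rewrite kE jj.
move: kZ; rewrite -(min2_union (cT _ jZ) (cT _ j'Z) (TZ _) (TZ _) ne) inE {2}kE.
by rewrite (negPf (zzP _ j'Z).2) orbF.
Qed.

End Minimal.

Lemma set2_circuit x y : x != y -> x \in G -> y \in G -> (0 < h [set x; y])%N -> circuit [set x; y].
Proof.
move=> xy xG yG hxy; rewrite /circuit hxy subUset !sub1set xG yG /=.
apply/forall_inP => i; rewrite !inE => /orP[] /eqP ->.
  by rewrite setU1K ?inE // (ws1 S).
by rewrite setUC setU1K ?inE 1?eq_sym // (ws1 S).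
Qed.

Lemma symdiff_set2 X x y : x \in X -> y \in X -> x != y ->
  symdiff (X :\ x) (X :\ y) = [set x; y].
Proof.
move=> xX yX xy; apply/setP => k; rewrite !inE.
case: (eqVneq k x) => [->|kx] /=; first by rewrite xX xy.
case: (eqVneq k y) => [->|ky] /=; first by rewrite yX.
by case: (k \in X).
Qed.

Lemma deleted_circuits_pair Z x y : x \in Z -> y \in Z -> x != y ->
  circuit (Z :\ x) -> circuit (Z :\ y) -> (0 < h [set x; y])%N.
Proof.
move=> xZ yZ xy cx cy; rewrite -(symdiff_set2 xZ yZ xy); apply: symdiff_pos => //.
apply/eqP => /setP/(_ y).
by rewrite !inE eqxx yZ andbT (eq_sym y) xy.
Qed.

Lemma pair_circuit_trans x y z : x != y -> y != z -> x != z ->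
  circuit [set x; y] -> circuit [set y; z] -> circuit [set x; z].
Proof.
move=> xy yz xz c1 c2.
have mem C k : circuit C -> k \in C -> k \in G by move/circuit_sub/subsetP; apply.
have xG := mem _ x c1 (set21 _ _); have zG := mem _ z c2 (set22 _ _).
apply: set2_circuit => //.
have <- : symdiff [set x; y] [set y; z] = [set x; z].
  apply/setP => k; rewrite !inE; case: (eqVneq k x) => [->|kx] /=.
    by rewrite (negPf xy) (negPf xz).
  case: (eqVneq k y) => [->|ky] /=; first by rewrite (negPf yz).
  by case: (k == z).
apply: symdiff_pos => //; apply/eqP => /setP/(_ x).
by rewrite !inE eqxx (negPf xy) (negPf xz).
Qed.

(* A minimal subset of C1 U C2 with h >= 2 either consists of three pairwise
   parallel elements, or splits into two circuits, each meeting both C1 \ C2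
   and C2 \ C1, which are then pairs by induction. *)
Lemma circuits_meet C1 C2 : circuit C1 -> circuit C2 -> C1 != C2 -> ~~ [disjoint C1 & C2] ->
  #|C1| = 2%N /\ #|C2| = 2%N.
Proof.
have [m] := ubnP #|C1 :|: C2|; elim: m => // m IH in C1 C2 *; rewrite ltnS => Um c1 c2 ne meet.
have UG : C1 :|: C2 \subset G by rewrite subUset !circuit_sub.
have [Z [ZU hZ minZ]] := ws_minimal UG (circuits_union c1 c2 ne).
have ZG := subset_trans ZU UG.
have circ_in (C C' : {set 'I_p}) : circuit C -> circuit C' -> C \subset C' -> C = C'.
  move=> cC cC' s; apply/eqP; apply: contraT => nC.
  by have := circuit_pos cC; rewrite (circuit_proper cC') // properEneq nC.
case: (min2_dichotomy ZG hZ minZ) => [[_ [P [Q [cP cQ dPQ PQ]]]]|del].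
  have PU : P \subset C1 :|: C2 by apply: subset_trans ZU; rewrite -PQ subsetUl.
  have QU : Q \subset C1 :|: C2 by apply: subset_trans ZU; rewrite -PQ subsetUr.
  have neq B B' D D' : circuit B -> circuit B' -> circuit D -> circuit D' -> ~~ [disjoint D & D'] ->
      [disjoint B & B'] -> B' \subset D :|: D' -> B != D.
    move=> cB cB' cD cD' mD dB B'U; apply/eqP => BD; subst D.
    have B'D' : B' = D'.
      apply: circ_in => //; apply/subsetP => k kB'; have := subsetP B'U _ kB'.
      by rewrite inE (disjointFl dB kB').
    by rewrite -B'D' dB in mD.
  have outside B D D' : circuit B -> circuit D -> B != D -> B \subset D :|: D' ->
      exists k, [/\ k \in B, k \notin D & k \in D'].
    move=> cB cD nBD BU; have /subsetPn[k kB kD] : ~~ (B \subset D).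
      by apply: contra nBD => s; apply/eqP/circ_in.
    by exists k; split=> //; have := subsetP BU _ kB; rewrite inE (negPf kD).
  have meet' : ~~ [disjoint C2 & C1] by rewrite disjoint_sym.
  have dQP : [disjoint Q & P] by rewrite disjoint_sym.
  have QU' : Q \subset C2 :|: C1 by rewrite setUC.
  have PU' : P \subset C2 :|: C1 by rewrite setUC.
  have nP1 := neq _ _ _ _ cP cQ c1 c2 meet dPQ QU.
  have nP2 := neq _ _ _ _ cP cQ c2 c1 meet' dPQ QU'.
  have nQ1 := neq _ _ _ _ cQ cP c1 c2 meet dQP PU.
  have nQ2 := neq _ _ _ _ cQ cP c2 c1 meet' dQP PU'.
  have [k1 [k1P k1C1 k1C2]] := outside _ _ _ cP c1 nP1 PU.
  have [k2 [k2P k2C2 k2C1]] := outside _ _ _ cP c2 nP2 PU'.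
  have [l1 [l1Q l1C1 l1C2]] := outside _ _ _ cQ c1 nQ1 QU.
  have [l2 [l2Q l2C2 l2C1]] := outside _ _ _ cQ c2 nQ2 QU'.
  have lt (D : {set 'I_p}) l : D \subset C1 :|: C2 -> l \in C1 :|: C2 -> l \notin D -> l \in Q -> (#|P :|: D| < m)%N.
    move=> DU lU lD lQ; apply: leq_trans Um; apply: proper_card.
    apply/properP; split; first by rewrite subUset PU.
    by exists l => //; rewrite inE (negPf lD) orbF (disjointFl dPQ).
  have [_ ->] : #|P| = 2%N /\ #|C1| = 2%N.
    apply: IH => //; last by apply/pred0Pn; exists k2; rewrite /= k2P.
    by apply: (lt C1 l1 (subsetUl _ _) _ l1C1 l1Q); rewrite inE l1C2 orbT.
  have [_ ->] : #|P| = 2%N /\ #|C2| = 2%N.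
    apply: IH => //; last by apply/pred0Pn; exists k1; rewrite /= k1P.
    by apply: (lt C2 l2 (subsetUr _ _) _ l2C2 l2Q); rewrite inE l2C1.
  by [].
have pairs x y : x \in Z -> y \in Z -> x != y -> circuit [set x; y].
  move=> xZ yZ xy; apply: set2_circuit => //; rewrite ?(subsetP ZG) //.
  exact: (deleted_circuits_pair xZ yZ xy (del x xZ) (del y yZ)).
have pair_eq C x y : circuit C -> x \in Z -> y \in Z -> x != y -> x \in C -> y \in C -> C = [set x; y].
  move=> cC xZ yZ xy xC yC; apply/esym/circ_in => //; first exact: pairs.
  by apply/subsetP => k; rewrite !inE => /orP[] /eqP ->.
have card2 x y : x != y -> #|[set x; y]| = 2%N by move=> xy; rewrite cards2 xy.
have ZE k : k \in Z -> (k \in C1) || (k \in C2) by move/(subsetP ZU); rewrite inE.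
have [x xZ] : exists x, x \in Z.
  have [Z0|[x xZ]] := set_0Vmem Z; last by exists x.
  by rewrite Z0 (ws0 S) in hZ.
have [y yZ yx] := ws_two x ZG (ltnW hZ).
have [z zZ zx] := ws_two x (circuit_sub (del y yZ)) (circuit_pos (del y yZ)).
move: zZ; rewrite !inE => /andP[zy zZ].
(* Of three pairwise parallel elements two lie in the same circuit [C], which is then that pair. A
   point where [C'] meets it forms with [z'] a parallel pair inside [C']. *)
have main C C' x' y' z' : circuit C -> circuit C' -> ~~ [disjoint C & C'] -> C != C' ->
    x' \in Z -> y' \in Z -> z' \in Z -> x' != y' -> x' != z' -> y' != z' ->
    x' \in C -> y' \in C -> z' \in C' -> #|C| = 2%N /\ #|C'| = 2%N.
  move=> cC cC' mC nC xZ' yZ' zZ' xy' xz' yz' xC yC zC'.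
  have CE := pair_eq C x' y' cC xZ' yZ' xy' xC yC.
  split; first by rewrite CE card2.
  move: mC => /pred0Pn[k /= /andP[kC kC']]; move: kC; rewrite CE !inE => /orP[] /eqP kE; subst k.
    by rewrite (pair_eq C' x' z') // card2.
  by rewrite (pair_eq C' y' z') // card2.
have meet' : ~~ [disjoint C2 & C1] by rewrite disjoint_sym.
have ne' : C2 != C1 by rewrite eq_sym.
have xy : x != y by rewrite eq_sym.
have xz : x != z by rewrite eq_sym.
have yz : y != z by rewrite eq_sym.
have same3 C : circuit C -> x \in C -> y \in C -> z \in C -> False.
  move=> cC xC yC zC; move: zC; rewrite (pair_eq C x y cC xZ yZ xy xC yC).
  by rewrite !inE (negPf zx) (negPf zy).
have [x1|x2] := orP (ZE x xZ); have [y1|y2] := orP (ZE y yZ); have [z1|z2] := orP (ZE z zZ).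
- by case: (same3 C1).
- exact: (main C1 C2 x y z).
- by apply: (main C1 C2 x z y) => //; rewrite eq_sym.
- by have [] := main C2 C1 y z x c2 c1 meet' ne' yZ zZ xZ yz yx zx y2 z2 x1.
- exact: (main C1 C2 y z x).
- by have [] := main C2 C1 x z y c2 c1 meet' ne' xZ zZ yZ xz xy zy x2 z2 y1.
- by have [] := main C2 C1 x y z c2 c1 meet' ne' xZ yZ zZ xy xz yz x2 y2 z1.
- by case: (same3 C2).
Qed.

End Circuits.

(** * Sums of rows divisible by 2 or 4 *)
Section Words.
Variables (R : archiRealFieldType) (p n : nat) (A : 'M[R]_(p, n)).
Hypothesis A01 : forall i c, A i c \in [:: 0; 1; -1].
Implicit Types (X Y Z C T I G : {set 'I_p}) (f g : 'I_p -> 'I_n).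
Local Notation W Y f := (pinv A Y f).
Local Notation pow2 := (pow2 R).

Lemma int_norm (x : R) : `|x| \is a Num.int -> x \is a Num.int.
Proof. by case: (ger0P x) => // _; rewrite rpredN. Qed.

Lemma half_not_int : (2 : R)^-1 \is a Num.int -> False.
Proof.
move/intrP=> [z e]; have : (1 : R) = (2 * z)%:~R.
  by rewrite intrM -e mulfV // pnatr_eq0.
by move/eqP; rewrite -[1]/(1%:~R) eqr_int => /eqP; lia.
Qed.

(** Pairing the signed sum with column [i1] of the inverse returns the sign of row [i1]. If the sum
    is divisible by [2^(t+1)] while the column has denominators at most [2^t], that sign would be
    even. *)
Lemma signed_sum_pow2 t T f (s : 'I_p -> bool) i1 : i1 \in T -> minor A T f != 0 ->
  (forall c, (\sum_(i in T) (-1) ^+ s i * A i c) / pow2 t.+1 \is a Num.int) ->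
  (forall j, j \in T -> W T f j i1 * pow2 t \is a Num.int) -> False.
Proof.
move=> i1T nz sw Wint; apply: half_not_int.
have e : \sum_(j in T) (\sum_(i in T) (-1) ^+ s i * A i (f j)) * W T f j i1 = (-1) ^+ s i1.
  under eq_bigr => j _ do rewrite mulr_suml.
  rewrite exchange_big /= (bigD1 i1) //= [X in _ + X]big1 => [|i /andP[iT ii]].
    rewrite addr0; under eq_bigr => j _ do rewrite -mulrA.
    rewrite -mulr_sumr; have /matrixP/(_ i1 i1) := padded_pinv nz.
    rewrite !mxE eqxx (bigID (mem T)) /= [X in _ + X]big1 => [|j jT]; last first.
      by rewrite mxE (negPf jT) andbF (_ : (i1 == j) = false) ?mul0r //; apply: contraNF jT => /eqP <-.
    rewrite addr0 => e; rewrite -[RHS]mulr1 -[X in _ = _ * X]e; congr (_ * _).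
    by apply: eq_bigr => j jT; rewrite mxE i1T jT.
  under eq_bigr => j _ do rewrite -mulrA.
  rewrite -mulr_sumr; have /matrixP/(_ i i1) := padded_pinv nz.
  rewrite !mxE (negPf ii) (bigID (mem T)) /= [X in _ + X]big1 => [|j jT]; last first.
    by rewrite mxE (negPf jT) andbF (_ : (i == j) = false) ?mul0r //; apply: contraNF jT => /eqP <-.
  rewrite addr0 => e; rewrite -[RHS](mulr0 ((-1) ^+ s i)) -[X in _ = _ * X]e; congr (_ * _).
  by apply: eq_bigr => j jT; rewrite mxE iT jT.
rewrite (_ : 2^-1 = (-1) ^+ s i1 * ((-1) ^+ s i1 / 2)); last by rewrite mulrA -signr_addb addbb mul1r.
rewrite rpredM ?rpred_sign // -e mulr_suml rpred_sum // => j jT.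
rewrite (_ : _ / 2 = (\sum_(i in T) (-1) ^+ s i * A i (f j)) / pow2 t.+1 * (W T f j i1 * pow2 t)).
  by rewrite rpredM ?sw ?Wint.
rewrite pow2S invfM -!mulrA; congr (_ * _); rewrite mulrC; congr (_ * _).
by rewrite mulrCA mulVf ?mulr1 // gt_eqF ?pow2_gt0.
Qed.

(** Row [j] of the inverse times [A] has entries 0 or a sign, by Cramer's rule. When all nonzero
    entries of that row have absolute value [2^-(t+1)], this product is a signed sum of rows over
    its support, divided by [2^(t+1)]. *)
Lemma row_signed_sum t G (e : {set 'I_p} -> nat) Y f j : nzminor A G -> graded A e G ->
  Y \subset G -> minor A Y f != 0 -> j \in Y ->
  (forall i, i \in Y -> W Y f j i != 0 -> `|W Y f j i| = (pow2 t.+1)^-1) ->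
  exists s : 'I_p -> bool, forall c,
    (\sum_(i in pinv_support A Y f j) (-1) ^+ s i * A i c) / pow2 t.+1 \is a Num.int.
Proof.
move=> nzG eG YG nz jY Wj; exists (fun i => W Y f j i < 0) => c.
have := int_of_01 (graded_pinv_col eG c YG nz jY).
rewrite (_ : \sum_(i in Y) _ = (\sum_(i in pinv_support A Y f j) (-1) ^+ (W Y f j i < 0)%R * A i c) / pow2 t.+1) //.
rewrite mulr_suml (bigID (fun i => W Y f j i == 0)) /= big1 ?add0r => [|i /andP[_ /eqP ->]]; last by rewrite mul0r.
apply: eq_big => [i|i /andP[iY wi]]; first by rewrite inE.
by rewrite mulrAC {1}[W Y f j i]numEsign (Wj i iY wi).
Qed.

Definition even_word T := forall c, (\sum_(i in T) A i c) / 2 \is a Num.int.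

Lemma sign_half_int (b : bool) (x : R) : x \is a Num.int -> (-1) ^+ b * x / 2 - x / 2 \is a Num.int.
Proof.
move=> xi; case: b; rewrite ?expr0 ?expr1 ?mul1r ?mulN1r ?subrr ?rpred0 //.
by rewrite mulNr -opprD -splitr rpredN.
Qed.

Lemma sum_symdiff T T' (F : 'I_p -> R) :
  \sum_(i in T) F i + \sum_(i in T') F i =
  \sum_(i in symdiff T T') F i + 2 * \sum_(i in T :&: T') F i.
Proof.
have s1 : symdiff T T' :&: T = T :\: T'.
  by apply/setP => i; rewrite !inE; case: (i \in T); rewrite ?andbT ?orbF ?andbF.
have s2 : symdiff T T' :\: T = T' :\: T.
  by apply/setP => i; rewrite !inE; case: (i \in T); rewrite ?andbF.
rewrite (big_setID T' (A := T)) (big_setID T (A := T')) (big_setID T (A := symdiff T T')) /=.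
by rewrite s1 s2 (setIC T'); ring.
Qed.

Lemma even_word_symdiff T T' : even_word T -> even_word T' -> even_word (symdiff T T').
Proof.
move=> w w' c; have e := sum_symdiff T T' (fun i => A i c).
rewrite (_ : \sum_(i in symdiff T T') A i c =
  \sum_(i in T) A i c + \sum_(i in T') A i c - 2 * \sum_(i in T :&: T') A i c); last by rewrite e addrK.
rewrite mulrBl mulrDl rpredB ?rpredD ?w ?w' //.
by rewrite mulrAC mulfV ?pnatr_eq0 // mul1r rpred_sum // => i _; apply: int01.
Qed.

Section Instance0.
Variables (e : {set 'I_p} -> nat) (G : {set 'I_p}).
Hypotheses (nzG : nzminor A G) (eG : graded A e G).

Lemma word_system0 : word_system A G e even_word.
Proof.
split=> //.
- exact: graded0 nzG eG.
- exact: graded1 nzG eG.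
- exact: graded_mono1 nzG eG.
- exact: graded_gap nzG eG.
- by move=> Y f i i' YG _; apply: graded_gap1 eG _ _ _ _ YG.
- by move=> Y f i i' YG _; apply: graded_gap0 eG _ _ _ _ YG.
- move=> T TG T0 w; rewrite lt0n; apply/eqP => eT.
  have [f nz] := nzminor_sub TG nzG; have [i1 i1T] := set0Pn _ T0.
  apply: (@signed_sum_pow2 0 T f (fun=> false) i1) => // [c|j jT].
    rewrite /pow2 expr1; under eq_bigr => i _ do rewrite expr0 mul1r.
    exact: w.
  rewrite /pow2 expr0 mulr1; have [->|wj] := eqVneq (W T f j i1) 0; first by rewrite rpred0.
  have : `|W T f j i1| = 1.
    rewrite (graded_pinv eG) // eT (_ : e (T :\ i1) = 0%N) ?divr1 //.
    by apply/eqP; rewrite -leqn0 -eT; apply: (graded_mono1 A01 nzG eG).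
  case: (ger0P (W T f j i1)) => _; first by move=> ->; rewrite rpred1.
  by move=> /eqP; rewrite eqr_oppLR => /eqP ->; rewrite rpredN rpred1.
- by move=> T T' _ _; apply: even_word_symdiff.
move=> Y f j YG _ nz jY he.
have [i iY wi|s sw c] := @row_signed_sum 0 G e Y f j nzG eG YG nz jY.
  rewrite (graded_pinv eG) // -(he i iY) pow2S invfM mulrCA mulfV ?mulr1; first by rewrite /pow2 expr1.
  by rewrite gt_eqF ?pow2_gt0.
have := sw c; rewrite /pow2 expr1 => h.
rewrite -[X in X / 2](subrK (\sum_(i in pinv_support A Y f j) (-1) ^+ s i * A i c)) mulrDl rpredD //.
rewrite -sumrB mulr_suml rpred_sum // => i _; rewrite -opprB mulNr rpredN mulrBl.
exact/sign_half_int/int01.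
Qed.

End Instance0.

Section Instance1.
Variables (e : {set 'I_p} -> nat) (I : {set 'I_p}) (i0 : 'I_p).
Hypotheses (nzI : nzminor A I) (eI : graded A e I) (i0I : i0 \in I).
Hypothesis pairsI : forall x y, x \in I -> y \in I -> x != y -> (0 < e [set x; y])%N.

(** A subset of an interlace has exponent at least [#|Y|.-1], so the truncated subtraction is exact
    there ([excessE]). For the whole interlace, thin means excess 0 and thick excess 1. *)
Definition excess Y := (e Y - #|Y|.-1)%N.

(* In an interlace all rows are congruent modulo 2, so a signed sum of rows
   divisible by 4 amounts to an unsigned one up to multiples of 2 A_i0. *)
Definition quad_word T := exists m : nat, forall c,
  (\sum_(i in T) A i c) / 4 - m%:R * A i0 c / 2 \is a Num.int.

Let S0 := word_system0 nzI eI.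

Lemma pair_half i c : i \in I -> (A i c - A i0 c) / 2 \is a Num.int.
Proof.
move=> iI; have [->|ii] := eqVneq i i0; first by rewrite subrr mul0r rpred0.
have /(circuit_word S0)/(_ c) := set2_circuit S0 ii iI i0I (pairsI iI i0I ii).
rewrite big_setU1 ?inE // big_set1 => h.
rewrite (_ : _ / 2 = (A i c + A i0 c) / 2 - A i0 c); last by field.
by rewrite rpredB // int01.
Qed.

Lemma sum_half T c : T \subset I ->
  (\sum_(i in T) A i c) / 2 - #|T|%:R * A i0 c / 2 \is a Num.int.
Proof.
move=> TI; rewrite -mulrBl mulr_natl -sumr_const -sumrB mulr_suml rpred_sum // => i iT.
by apply: pair_half; apply: (subsetP TI).
Qed.

(** By supermodularity, adding [i] to [Y :\ i] gains at least as much as adding it to a single other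
    row, where it creates a pair of positive exponent. *)
Lemma interlace_step Y i : Y \subset I -> i \in Y -> (1 < #|Y|)%N -> (e (Y :\ i) < e Y)%N.
Proof.
move=> YI iY Y2; have [Y0|[i' i'Y]] := set_0Vmem (Y :\ i).
  by move: Y2; rewrite (cardsD1 i) iY Y0 cards0.
move: (i'Y); rewrite !inE => /andP[ii i'Y'].
have := @ws_marginal _ _ _ _ _ _ _ S0 [set i'] (Y :\ i) i.
rewrite sub1set setD1K // setD11 => /(_ i'Y YI isT).
rewrite (ws1 S0) ?(subsetP YI) //.
have : (0 < e [set i; i'])%N by apply: pairsI; rewrite ?(subsetP YI) // eq_sym.
by lia.
Qed.

Lemma excessE Y : Y \subset I -> e Y = (excess Y + #|Y|.-1)%N.
Proof.
move=> YI; rewrite subnK //.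
have [m] := ubnP #|Y|; elim: m => // m IH in Y YI *; rewrite ltnS => Ym.
have [Y2|] := ltnP 1 #|Y|; last by case: #|Y| => [|[]].
have [i iY] : exists i, i \in Y by apply/set0Pn; rewrite -card_gt0; case: #|Y| Y2.
have YiI := subset_trans (subD1set Y i) YI.
have := interlace_step YI iY Y2; have := IH _ YiI.
by move: Ym Y2; rewrite (cardsD1 i Y) iY; case: #|_| => [|k] //=; lia.
Qed.

Lemma small_excess Y : Y \subset I -> (#|Y| <= 2)%N -> excess Y = 0%N.
Proof.
move=> YI; rewrite /excess; case: (posnP #|Y|) => [/cards0_eq ->|Y0]; first by rewrite (ws0 S0).
rewrite leq_eqVlt => /orP[|].
  case/cards2P=> x [y] [xy YE]; subst Y.
  have [xI yI] : x \in I /\ y \in I by split; apply: (subsetP YI); rewrite !inE eqxx ?orbT.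
  have := ws_gap S0 YI (set21 x y) (set22 x y) xy.
  rewrite setU1K ?inE // (setUC [set x]) setU1K ?inE 1?eq_sym // !(ws1 S0) //.
  rewrite (_ : [set y] :\ y = set0) ?(ws0 S0) ?cards2 1?eq_sym ?xy //; first by lia.
  by apply/setP => k; rewrite !inE andNb.
rewrite ltnS => Y1; have /cards1P[x YE] : #|Y| == 1%N by rewrite eqn_leq Y1.
by subst Y; rewrite (ws1 S0) // -sub1set.
Qed.

(** From three rows on the predecessors are exact and cancel in the gap, so [e] and [excess] have
    the same gap. *)
Lemma excess_gapE Y i i' : Y \subset I -> i \in Y -> i' \in Y -> i != i' -> (2 < #|Y|)%N ->
  [/\ e Y = (excess Y + #|Y|.-1)%N, e (Y :\ i) = (excess (Y :\ i) + #|Y|.-2)%N,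
      e (Y :\ i') = (excess (Y :\ i') + #|Y|.-2)%N &
      e (Y :\ i :\ i') = (excess (Y :\ i :\ i') + #|Y|.-1.-2)%N].
Proof.
move=> YI iY i'Y ii Y3; have sub k := subset_trans (subD1set Y k) YI.
have i'Y' : i' \in Y :\ i by rewrite !inE eq_sym ii.
have c1 : #|Y :\ i| = #|Y|.-1 by rewrite (cardsD1 i Y) iY.
have c2 : #|Y :\ i'| = #|Y|.-1 by rewrite (cardsD1 i' Y) i'Y.
have c3 : #|Y :\ i :\ i'| = #|Y|.-2 by rewrite -c1 (cardsD1 i' (Y :\ i)) i'Y'.
have sub2 := subset_trans (subD1set (Y :\ i) i') (sub i).
by rewrite !excessE // c1 c2 c3; split=> //; lia.
Qed.

Lemma excess_pos_card Y : Y \subset I -> (0 < excess Y)%N -> (2 < #|Y|)%N.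
Proof. by move=> YI h; rewrite ltnNge; apply/negP => /(small_excess YI) h0; rewrite h0 in h. Qed.

Lemma word_system1 : word_system A I excess quad_word.
Proof.
split=> //.
- by rewrite /excess (ws0 S0).
- by move=> i iI; rewrite /excess (ws1 S0).
- move=> Y i YI; have [iY|iY] := boolP (i \in Y); last first.
    by rewrite (setDidPl _) // disjoint_sym disjoints1.
  rewrite /excess; have := cardsD1 i Y; rewrite iY => cY.
  have [Y2|Y1] := ltnP 1 #|Y|; first by have := interlace_step YI iY Y2; lia.
  rewrite (_ : Y :\ i = set0) ?(ws0 S0) //.
  by apply/eqP; rewrite -cards_eq0; lia.
- move=> Y i i' YI iY i'Y ii; have [Y3|Y2] := ltnP 2 #|Y|.
    have [e1 e2 e3 e4] := excess_gapE YI iY i'Y ii Y3.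
    by case: (ws_gap S0 YI iY i'Y ii); rewrite e1 e2 e3 e4; [left|right]; lia.
  left; rewrite !small_excess //; try by rewrite ?(leq_trans (subset_leq_card _) Y2) ?(subset_trans _ YI) ?subD1set.
  + by apply: subset_trans YI; apply: subset_trans (subD1set _ _) (subD1set _ _).
  + by apply: leq_trans Y2; apply: subset_leq_card; apply: subset_trans (subD1set _ _) (subD1set _ _).
- move=> Y f i i' YI hY nz iY i'Y ii E.
  have [e1 e2 e3 e4] := excess_gapE YI iY i'Y ii (excess_pos_card YI hY).
  have Y3 := excess_pos_card YI hY.
  have E' : (e (Y :\ i) + e (Y :\ i')).+1 = (e Y + e (Y :\ i :\ i'))%N by lia.
  exact: (graded_gap1 eI YI nz iY i'Y ii E').
- move=> Y f i i' YI hY nz iY i'Y ii E.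
  have [e1 e2 e3 e4] := excess_gapE YI iY i'Y ii (excess_pos_card YI hY).
  have Y3 := excess_pos_card YI hY.
  have E' : (e (Y :\ i) + e (Y :\ i'))%N = (e Y + e (Y :\ i :\ i'))%N by lia.
  exact: (graded_gap0 eI YI nz iY i'Y ii E').
- move=> T TI T0 [m w]; rewrite lt0n; apply/eqP => hT.
  have [f nz] := nzminor_sub TI nzI; have [i1 i1T] := set0Pn _ T0.
  have pow4 : pow2 2 = 4 by rewrite /pow2 -natrX.
  (* For odd [m], flipping the sign of row [i1] changes the sum by twice that row, and row [i1] is
     congruent to row [i0] modulo 2; this absorbs the odd multiple of [2 A_i0]. *)
  apply: (@signed_sum_pow2 1 T f (fun i => odd m && (i == i1)) i1) => // [c|j jT].
    have := w c; rewrite pow4.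
    have mE := odd_double_half m.
    case: (odd m) mE => mE /= wc.
      rewrite (bigD1 i1) //= eqxx expr1 mulN1r.
      rewrite (eq_bigr (fun i => A i c)) => [|i /andP[_ /negPf ->]]; last by rewrite expr0 mul1r.
      move: wc; rewrite (bigD1 i1) //= -mE; set r := \sum_(i in T | _) _ => wc.
      have -> : (- A i1 c + r) / 4 = ((A i1 c + r) / 4 - (1 + m./2.*2)%:R * A i0 c / 2)
          + (m./2%:R * A i0 c - (A i1 c - A i0 c) / 2).
        by rewrite natrD -muln2 natrM; field.
      by rewrite rpredD // rpredB ?pair_half ?(subsetP TI) // rpredM ?int01 // natr_int.
    under eq_bigr => i _ do rewrite expr0 mul1r.
    rewrite -[_ / 4](subrK (m%:R * A i0 c / 2)) rpredD //.
    by rewrite -mE add0n -muln2 natrM mulrAC mulfK ?pnatr_eq0 // rpredM ?int01 ?natr_int.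
  rewrite /pow2 expr1; have [->|wj] := eqVneq (W T f j i1) 0; first by rewrite mul0r rpred0.
  (* With excess 0 a nonzero entry of the inverse has absolute value 1/2, or 1 when [T] is a single
     row. *)
  have : `|W T f j i1 * 2| = 1 \/ `|W T f j i1 * 2| = 2.
    rewrite normrM normr_nat (graded_pinv eI) // (excessE TI) hT add0n.
    have [T2|T1] := ltnP 1 #|T|; [left|right].
      have TiI := subset_trans (subD1set T i1) TI.
      have -> : e (T :\ i1) = #|T|.-2.
        have := interlace_step TI i1T T2; rewrite (excessE TI) hT (excessE TiI).
        by have := cardsD1 i1 T; rewrite i1T; move: T2; move: (excess _) #|T| #|_ :\ _| => x a k; clear; lia.
      have -> : #|T|.-1 = #|T|.-2.+1 by move: T2; case: #|T| => [|[]].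
      rewrite pow2S invfM mulrCA mulfV ?mulr1 ?mulVf ?pnatr_eq0 //.
      by rewrite gt_eqF ?pow2_gt0.
    have c1 : #|T| = 1%N by apply/eqP; rewrite eqn_leq T1 card_gt0.
    have -> : T :\ i1 = set0 by apply/eqP; rewrite -cards_eq0; have := cardsD1 i1 T; rewrite i1T c1; case: #|_ :\ _|.
    by rewrite (ws0 S0) c1 divr1 mul1r.
  by case=> h; apply: int_norm; rewrite h ?rpred1 // (natr_int _ 2).
(* The symmetric difference subtracts twice the sum over [T :&: T'], which is congruent modulo 2 to
   [#|T :&: T'|] times row [i0]. *)
- move=> T T' TI T'I [m w] [m' w']; exists (m + m' + #|T :&: T'|)%N => c.
  have := sum_symdiff T T' (fun i => A i c).
  have := sum_half c (subset_trans (subsetIl T T') TI).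
  have := w c; have := w' c.
  set a := \sum_(i in T) _; set b := \sum_(i in T') _; set s := \sum_(i in symdiff _ _) _.
  set d := \sum_(i in T :&: T') _; set k := #|_| => hb ha hd E.
  rewrite (_ : _ - _ = (a / 4 - m%:R * A i0 c / 2) + (b / 4 - m'%:R * A i0 c / 2)
     - (d / 2 - k%:R * A i0 c / 2) - k%:R * A i0 c).
    apply: rpredB; last by rewrite rpredM ?int01 ?natr_int.
    by apply: rpredB => //; apply: rpredD.
  have -> : s = a + b - 2 * d by rewrite E addrK.
  by rewrite !natrD; field.
move=> Y f j YI hY nz jY he; have Y3 := excess_pos_card YI hY.
have [i iY wi|s sw] := @row_signed_sum 1 I e Y f j nzI eI YI nz jY.
  rewrite (graded_pinv eI) //.
  have -> : e Y = (e (Y :\ i) + 2)%N.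
    rewrite !excessE ?(subset_trans (subD1set _ _) YI) //.
    by have := he i iY; have := cardsD1 i Y; rewrite iY; lia.
  by rewrite pow2D invfM mulrA mulfV ?mul1r // gt_eqF ?pow2_gt0.
set T := pinv_support A Y f j.
have TI : T \subset I by apply: subset_trans YI; apply: pinv_support_sub.
(* Making all signs positive adds twice the sum of the negated rows; their number is the required
   multiple of [2 A_i0]. *)
exists #|T :&: [set i | s i]| => c.
have := sw c; have := sum_half c (subset_trans (subsetIl T [set i | s i]) TI).
rewrite -/T (_ : pow2 2 = 4); last by rewrite /pow2 -natrX.
set k := #|_|; set d := \sum_(i in _ :&: _) _ => hd hs.
rewrite (_ : _ - _ = (\sum_(i in T) (-1) ^+ s i * A i c) / 4 + (d / 2 - k%:R * A i0 c / 2)).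
  by rewrite rpredD.
have -> : \sum_(i in T) A i c = \sum_(i in T) (-1) ^+ s i * A i c + 2 * d.
  rewrite (big_setID [set i | s i] (A := T)) /= [X in _ = X + _](big_setID [set i | s i]) /= -/d.
  rewrite (eq_bigr (fun i => - A i c) (P := fun i => i \in T :&: _)) => [|i]; last first.
    by rewrite !inE => /andP[_ ->]; rewrite expr1 mulN1r.
  rewrite [X in _ = _ + X + _](eq_bigr (fun i => A i c)) => [|i]; last first.
    by rewrite !inE => /andP[/negPf -> _]; rewrite expr0 mul1r.
  by rewrite sumrN -/d; ring.
by field.
Qed.

End Instance1.
End Words.

(** * Interlaces are thin or thick *)

Section Interlaces.
Variables (R : archiRealFieldType) (p n : nat) (A : 'M[R]_(p, n)).
Hypothesis A01 : forall i c, A i c \in [:: 0; 1; -1].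
Variables (e : {set 'I_p} -> nat) (I : {set 'I_p}).
Hypotheses (nzI : nzminor A I) (eI : graded A e I).
Hypothesis pairsI : forall x y, x \in I -> y \in I -> x != y -> (0 < e [set x; y])%N.
Implicit Types (X Y Z C T : {set 'I_p}) (f g : 'I_p -> 'I_n).
Local Notation W Y f := (pinv A Y f).

(** Rows of an interlace are congruent modulo 2, and among 0, 1, -1 only 0 is even. *)
Lemma same_support i i' c : i \in I -> i' \in I -> A i c = 0 -> A i' c = 0.
Proof.
move=> iI i'I Ai0; have := pair_half A01 nzI eI iI pairsI c i'I; rewrite Ai0 subr0.
move: (A01 i' c); rewrite !inE => /or3P[] /eqP -> //.
  by rewrite mul1r => /half_not_int.
by rewrite mulNr mul1r rpredN => /half_not_int.
Qed.

(** Take a minimal [Z] of excess at least 2. If all [Z :\ z] were circuits, some pair would have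
    positive excess, which two rows cannot have. Otherwise [Z] splits into circuits [P] and [Q], and
    the rows of the inverse are supported on [P], on [Q], or, for at most one row, on all of [Z].
    Such a nearly block diagonal inverse contradicts the common support of the rows of an
    interlace. *)
Lemma interlace_excess_le1 Y : Y \subset I -> (excess e Y <= 1)%N.
Proof.
have [I0|[i0 i0I]] := set_0Vmem I.
  by rewrite I0 subset0 => /eqP ->; rewrite /excess (graded0 nzI eI).
have S1 := word_system1 A01 nzI eI i0I pairsI.
move=> YI; rewrite leqNgt; apply/negP => hY.
have [Z [ZY hZ minZ]] := ws_minimal YI hY.
have ZI := subset_trans ZY YI.
case: (min2_dichotomy S1 ZI hZ minZ) => [[hZ2 [P [Q [cP cQ dPQ PQ]]]]|del]; last first.
  have [x xZ] : exists x, x \in Z.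
    have [Z0|[x xZ]] := set_0Vmem Z; last by exists x.
    by rewrite Z0 (ws0 S1) in hZ.
  have [y yZ yx] := ws_two S1 x ZI (ltnW hZ).
  have xy : x != y by rewrite eq_sym.
  have := deleted_circuits_pair S1 xZ yZ xy (del x xZ) (del y yZ).
  rewrite (small_excess A01 nzI eI i0I) //; last by rewrite cards2 xy.
  by apply: subset_trans ZI; apply/subsetP => k; rewrite !inE => /orP[] /eqP ->.
have PZ : P \subset Z by rewrite -PQ subsetUl.
have QZ : Q \subset Z by rewrite -PQ subsetUr.
have h1 := min2_two_del S1 ZI hZ minZ hZ2.
have only C : circuit I (excess e) C -> C \subset Z -> C = P \/ C = Q.
  move=> cC CZ; have [->|nP] := eqVneq C P; first by left.
  have CP := min2_union S1 ZI hZ minZ cC cP CZ PZ nP.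
  have QC : Q \subset C.
    apply/subsetP => k kQ; have := subsetP QZ _ kQ.
    by rewrite -CP inE (disjointFl dPQ kQ) orbF.
  right; apply/eqP; apply: contraT => nQ.
  have := circuit_proper S1 cC (X := Q); rewrite properEneq eq_sym nQ QC => /(_ isT) h0.
  by have := circuit_pos cQ; rewrite h0.
have [f nz] := ws_minor S1 ZI.
pose T j := pinv_support A Z f j.
have TZ j : T j \subset Z by apply: pinv_support_sub.
have Tcase j : j \in Z -> [\/ T j = P, T j = Q | T j = Z].
  move=> jZ; have [cT|ncT] := boolP (circuit I (excess e) (T j)).
    by case: (only _ cT (TZ j)) => ->; [constructor 1|constructor 2].
  constructor 3; have [||||-> _] := @min2_word_circuit _ _ _ _ _ _ _ S1 Z ZI hZ minZ (T j) => //.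
  - have [i iZ wi] := pinv_row_nz nz jZ; apply/set0Pn; exists i.
    by rewrite inE iZ.
  - by apply: (ws_word_row S1) => //; [rewrite hZ2|move=> i iZ; rewrite h1].
have supp0 j i : i \in Z -> i \notin T j -> W Z f j i = 0.
  by move=> iZ; rewrite inE iZ /= negbK => /eqP.
(* [P] and [Q] are the only circuits in [Z], so removing an element of each leaves excess 0, and the
   gap is 0. *)
have cross j j' i i' : j \in Z -> j' \in Z -> T j = Z -> T j' = Z -> i \in P -> i' \in Q ->
    W Z f j i * W Z f j' i' = W Z f j i' * W Z f j' i.
  move=> jZ j'Z Tj Tj' iP i'Q.
  have iZ := subsetP PZ _ iP; have i'Z := subsetP QZ _ i'Q.
  have ii : i != i' by apply: contraTneq i'Q => <-; rewrite (disjointFr dPQ iP).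
  have nzT k l : T k = Z -> l \in Z -> W Z f k l != 0.
    by move=> Tk; rewrite -{1}Tk inE => /andP[].
  apply: (ws_gap0 S1 ZI _ nz iZ i'Z ii _ jZ j'Z); rewrite ?nzT //; first by rewrite hZ2.
  rewrite !h1 // hZ2; apply/eqP; rewrite eqn_add2l // eq_sym; apply: contraT.
  rewrite -lt0n => /(circuit_exists (min2_sub2 ZI _ _))[C CZ cC].
  move: CZ; rewrite !subsetD1 => /andP[/andP[CZ iC] i'C].
  by case: (only C cC CZ) => CE; rewrite CE ?iP ?i'Q in iC i'C.
have uniq_full j j' : j \in Z -> j' \in Z -> T j = Z -> T j' = Z -> j = j'.
  move=> jZ j'Z Tj Tj'; apply/eqP; apply: contraT => jj.
  have [i1 i1P] := circuit_nonempty S1 cP; have [k1 k1Q] := circuit_nonempty S1 cQ.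
  have c1 := cross _ _ _ _ jZ j'Z Tj Tj' i1P k1Q.
  have n1 : W Z f j' i1 != 0.
    have : i1 \in T j' by rewrite Tj' (subsetP PZ).
    by rewrite inE => /andP[].
  have n2 : W Z f j' k1 != 0.
    have : k1 \in T j' by rewrite Tj' (subsetP QZ).
    by rewrite inE => /andP[].
  have [i|/eqP] := @pinv_rows_indep _ _ _ _ _ _ nz j j' (W Z f j' i1) (W Z f j i1) jj; last by rewrite (negPf n1).
  have [iZ|iZ] := boolP (i \in Z); last first.
    have nj k : k \in Z -> (k == i) = false by move=> kZ; apply: contraNF iZ => /eqP <-.
    by rewrite !(pinv_out nz _ iZ) !nj // !mulr0.
  have /setUP[iP|iQ] : i \in P :|: Q by rewrite PQ.
    have ci := cross _ _ _ _ jZ j'Z Tj Tj' iP k1Q.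
    by apply: (mulIf n2); rewrite -mulrA ci [RHS]mulrAC c1 mulrCA mulrA.
  by rewrite mulrC -(cross _ _ _ _ jZ j'Z Tj Tj' i1P iQ).
(* [b] is the row of the inverse with full support if there is one, and arbitrary otherwise. *)
have [b bZ bP] : exists2 b, b \in Z & forall j, j \in Z -> j != b -> T j = P \/ T j = Q.
  have [/exists_inP[b bZ /eqP Tb]|] := boolP [exists b in Z, T b == Z].
    exists b => // j jZ jb; case: (Tcase j jZ) => [||Tj]; [by left|by right|].
    by case/eqP: jb; apply: uniq_full.
  rewrite negb_exists_in => /forall_inP nT; have [b bP] := circuit_nonempty S1 cP.
  exists b; first exact: (subsetP PZ).
  move=> j jZ _; case: (Tcase j jZ) => [||Tj]; [by left|by right|].
  by have := nT j jZ; rewrite Tj eqxx.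
have [i1 i1P] := circuit_nonempty S1 cP; have [k1 k1Q] := circuit_nonempty S1 cQ.
have Ab i : i \in Z -> A i (f b) != 0.
  move=> iZ; apply: contra nz => /eqP Ai; rewrite (minor_zero_col bZ) // => i' i'Z.
  by apply: same_support Ai; apply: (subsetP ZI).
(* x is column b of the basis cut down to P; W maps it into the span of e_b,
   hence x is a multiple of column b, which has no zero entry on Z. *)
pose x : 'cV[R]_p := \col_i if i \in P then A i (f b) else 0.
have Wx j : j != b -> (pinv A Z f *m x) j 0 = 0.
  move=> jb; have sumP : (pinv A Z f *m x) j 0 = \sum_(i in P) W Z f j i * A i (f b).
    rewrite mxE (bigID (mem P)) /= [X in _ + X]big1 ?addr0 => [|i iP].
      by apply: eq_bigr => i iP; rewrite mxE iP.
    by rewrite mxE (negPf iP) mulr0.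
  have [jZ|jZ] := boolP (j \in Z); last first.
    rewrite sumP big1 // => i iP; rewrite (pinv_out_row nz i jZ).
    by rewrite (_ : (j == i) = false) ?mul0r //; apply: contraNF jZ => /eqP ->; apply: (subsetP PZ).
  rewrite sumP; case: (bP j jZ jb) => Tj; last first.
    rewrite big1 // => i iP; rewrite supp0 ?mul0r ?(subsetP PZ) //.
    by rewrite Tj (disjointFr dPQ iP).
  have /matrixP/(_ j b) := pinv_padded nz; rewrite !mxE (negPf jb) => E; rewrite -[RHS]E.
  rewrite [RHS](bigID (mem P)) /= [X in _ = _ + X]big1 ?addr0 => [|i iP].
    by apply: eq_bigr => i iP; rewrite mxE (subsetP PZ _ iP) bZ.
  have [iZ|iZ] := boolP (i \in Z); first by rewrite supp0 ?mul0r // Tj.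
  by rewrite mxE (negPf iZ) /= (_ : (i == b) = false) ?mulr0 //; apply: contraNF iZ => /eqP ->.
have xE i : i \in Z -> x i 0 = A i (f b) * (pinv A Z f *m x) b 0.
  move=> iZ; rewrite -[x in LHS]mul1mx -(padded_pinv nz) -mulmxA mxE.
  rewrite (bigD1 b) //= big1 ?addr0 => [|j jb]; first by rewrite mxE iZ bZ.
  by rewrite Wx // mulr0.
have := xE k1 (subsetP QZ _ k1Q); rewrite mxE (disjointFl dPQ k1Q) => /esym/eqP.
rewrite mulf_eq0 (negPf (Ab _ (subsetP QZ _ k1Q))) /= => /eqP w0.
have := xE i1 (subsetP PZ _ i1P); rewrite mxE i1P w0 mulr0 => /eqP.
by rewrite (negPf (Ab _ (subsetP PZ _ i1P))).
Qed.

Lemma interlace_exponent Y : Y \subset I -> e Y = #|Y|.-1 \/ e Y = #|Y|.-1.+1.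
Proof.
move=> YI; have [I0|[i0 i0I]] := set_0Vmem I.
  by move: YI; rewrite I0 subset0 => /eqP ->; rewrite (graded0 nzI eI) cards0; left.
rewrite (excessE A01 nzI eI i0I pairsI YI); have := interlace_excess_le1 YI.
by case: (excess e Y) => [|[]] // _; [left|right].
Qed.

End Interlaces.

(** * Additivity over bricks *)
Section Assembly.
Variables (R : archiRealFieldType) (p n : nat) (A : 'M[R]_(p, n)).
Hypothesis A01 : forall i c, A i c \in [:: 0; 1; -1].
Hypothesis nzA : nzminor A setT.
Implicit Types (X Y Z : {set 'I_p}) (f g : 'I_p -> 'I_n).
Variables (K : nat) (B : 'I_K -> {set 'I_p}) (e : {set 'I_p} -> nat).
Hypothesis disjB : forall k l, k != l -> [disjoint B k & B l].
Hypothesis gradedB : forall k, graded A e (B k).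

Definition lace_like X := (0 < e X)%N /\ forall Y, Y \proper X -> e Y = 0%N.
Definition interlace_like X := forall x y, x \in X -> y \in X -> x != y -> (0 < e [set x; y])%N.

Hypothesis kindB : forall k, [\/ e (B k) = 0%N, lace_like (B k) | interlace_like (B k)].
Hypothesis mutualB : forall Y, (forall k, ~~ (Y \subset B k)) ->
  (forall k, lace_like (B k) -> ~~ (B k \subset Y)) ->
  (forall k, interlace_like (B k) -> (#|Y :&: B k| <= 1)%N) -> eqminor A Y 1.

Definition total_exponent Y := (\sum_k e (Y :&: B k))%N.
Local Notation F := total_exponent.

Lemma nzminor_all Y : nzminor A Y. Proof. by apply: nzminor_sub (subsetT Y) nzA. Qed.

Lemma brick_e0 (k : 'I_K) : e set0 = 0%N.
Proof. exact: graded0 (nzminor_all (B k)) (@gradedB k). Qed.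

Lemma total_exponent_split k Y : F Y = (e (Y :&: B k) + F (Y :\: B k))%N.
Proof.
rewrite /F (bigD1 k) //= [in RHS](bigD1 k) //=.
have -> : (Y :\: B k) :&: B k = set0.
  by apply/setP => i; rewrite !inE; case: (i \in B k); rewrite ?andbF.
rewrite (brick_e0 k) add0n; congr (_ + _)%N; apply: eq_bigr => l lk.
congr e; apply/setP => i; rewrite !inE; case iBl: (i \in B l); rewrite ?andbF //.
by rewrite (disjointFr (disjB lk) iBl).
Qed.

Lemma total_exponent0 : F set0 = 0%N.
Proof. by rewrite /F big1 // => k _; rewrite set0I (brick_e0 k). Qed.

Lemma total_exponent_brick k Y : Y \subset B k -> F Y = e Y.
Proof.
move=> YB; rewrite (total_exponent_split k) (setIidPl YB).
by move: YB; rewrite -setD_eq0 => /eqP ->; rewrite total_exponent0 addn0.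
Qed.

Lemma brick_small k Y : Y \subset B k -> (#|Y| <= 1)%N -> e Y = 0%N.
Proof.
move=> YB; rewrite leq_eqVlt => /orP[/cards1P[x YE]|].
  by rewrite YE (graded1 A01 (nzminor_all _) (@gradedB k)) // -sub1set -YE.
by rewrite ltnS leqn0 cards_eq0 => /eqP ->; exact: brick_e0 k.
Qed.

(** Deleting two rows of the lace leaves [2^q] or [2^(q+1)] as the value of a minor; deleting one
    row of the lace and [r] leaves [2^(q+1)] or [2^(q+2)]. Only [2^(q+1)] is on both lists. *)
Lemma eqminor_total_lace Y k r : (forall Z, (#|Z| < #|Y|)%N -> eqminor A Z (pow2 R (F Z))) ->
  lace_like (B k) -> B k \subset Y -> r \in Y -> r \notin B k -> eqminor A Y (pow2 R (F Y)).
Proof.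
move=> IH [eB minB] BY rY rB f nz.
have S0 := word_system0 A01 (nzminor_all (B k)) (@gradedB k).
have eB1 : e (B k) = 1%N.
  apply: (circuit_eq1 S0 (C := B k)); rewrite /circuit subxx eB; apply/forall_inP => i iB.
  by apply/eqP/minB; rewrite properD1.
have [b bB] : exists b, b \in B k.
  by have [B0|[b bB]] := set_0Vmem (B k); [rewrite B0 (ws0 S0) in eB|exists b].
have [b' b'B bb'] := ws_two S0 b (subxx _) eB.
have bY := subsetP BY _ bB; have b'Y := subsetP BY _ b'B.
have br : b != r by apply: contraNneq rB => <-.
set q := F (Y :\: B k); set q' := F (Y :\ r :\: B k).
have prop Z : b \notin Z -> e (Z :&: B k) = 0%N.
  move=> bZ; apply: minB; apply/properP; split; first exact: subsetIr.
  by exists b; rewrite // inE (negPf bZ).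
have FY : F Y = q.+1 by rewrite (total_exponent_split k) (setIidPr BY) eB1.
have del Z x : x \in B k -> Z :\ x :\: B k = Z :\: B k.
  move=> xB; apply/setP => i; rewrite !inE; case: (eqVneq i x) => [->|] //.
  by rewrite xB.
have Fb : F (Y :\ b) = q by rewrite (total_exponent_split k) prop ?setD11 // del.
have Fb' : F (Y :\ b') = q.
  rewrite (total_exponent_split k) del // minB //; apply/properP; split; first exact: subsetIr.
  by exists b'; rewrite // !inE eqxx.
have Fbb' : F (Y :\ b :\ b') = q.
  by rewrite (total_exponent_split k) prop ?inE ?eqxx ?andbF // !del.
have Fr : F (Y :\ r) = q'.+1.
  rewrite (total_exponent_split k) (_ : _ :&: _ = B k) ?eB1 //.
  apply/setIidPr/subsetP => i iB; rewrite !inE (subsetP BY _ iB) andbT.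
  by apply: contraNneq rB => <-.
have Fbr : F (Y :\ b :\ r) = q'.
  rewrite (total_exponent_split k) prop ?inE ?eqxx ?andbF // add0n.
  have -> : Y :\ b :\ r = Y :\ r :\ b by apply/setP => i; rewrite !inE andbCA.
  by rewrite del.
have c1 x : x \in Y -> (#|Y :\ x| < #|Y|)%N by move=> xY; rewrite [ltnRHS](cardsD1 x) xY.
have c2 x y : x \in Y -> (#|Y :\ x :\ y| < #|Y|)%N.
  by move=> xY; apply: leq_ltn_trans (c1 x xY); apply: subset_leq_card; apply: subD1set.
have eb := IH _ (c1 b bY); have eb' := IH _ (c1 b' b'Y); have er := IH _ (c1 r rY).
have ebb' := IH _ (c2 b b' bY); have ebr := IH _ (c2 b r bY).
rewrite Fb in eb; rewrite Fb' in eb'; rewrite Fr in er; rewrite Fbb' in ebb'; rewrite Fbr in ebr.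
have cancel x y : `|minor A Y f| * pow2 R x = pow2 R (y + x) -> `|minor A Y f| = pow2 R y.
  by rewrite pow2D; apply: mulIf; rewrite gt_eqF ?pow2_gt0.
have b'b : b != b' by rewrite eq_sym.
rewrite FY.
have [/cancel Dq|] := gap_exp nz bY b'Y b'b eb eb' ebb'; last first.
  by rewrite -addSn => /cancel.
have [|] := gap_exp nz bY rY br eb er ebr.
  by rewrite addnS -addSn => /cancel.
rewrite addnS -!addSn => /cancel; rewrite Dq => /pow2_inj h.
by exfalso; move: h; clear; lia.
Qed.

Lemma eqminor_total Y : eqminor A Y (pow2 R (F Y)).
Proof.
have [m] := ubnP #|Y|; elim: m => // m IHm in Y *; rewrite ltnS => Ym.
have IH Z : (#|Z| < #|Y|)%N -> eqminor A Z (pow2 R (F Z)).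
  by move=> ZY; apply: IHm; apply: leq_trans Ym.
have [/existsP[k YB]|/existsPn nsub] := boolP [exists k, Y \subset B k].
  by rewrite (total_exponent_brick YB); exact: (gradedB YB).
have [[k [intB I2]]|nint] := classic (exists k, interlace_like (B k) /\ (1 < #|Y :&: B k|)%N).
  have IB := subsetIr Y (B k).
  have cY : #|Y| = (#|Y :&: B k| + #|Y :\: B k|)%N by rewrite (cardsID (B k) Y).
  have YE : Y = (Y :&: B k) :|: (Y :\: B k) by rewrite setID.
  have cX Z : Z \subset Y :\: B k -> (#|Z| <= #|Y :\: B k|)%N by apply: subset_leq_card.
  rewrite (total_exponent_split k) pow2D [X in eqminor _ X _]YE.
  apply: (@eqminor_join _ _ _ A (Y :&: B k) (Y :\: B k) (fun Z => pow2 R (F Z))) => //.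
  - rewrite -setI_eq0; apply/eqP/setP => i; rewrite !inE.
    by case: (i \in B k); rewrite ?andbF.
  - move=> i i' c /(subsetP IB) iB /(subsetP IB) i'B.
    exact: (same_support A01 (nzminor_all (B k)) (@gradedB k) intB iB i'B).
  - move=> Z ZX; apply: IH; have := cX Z ZX; rewrite cY; move: I2; clear; lia.
  (* [Y] has a second row in [B k], so [i |: Z] is smaller than [Y] and the induction applies; the
     single row [i] contributes nothing to the total exponent. *)
  - move=> i Z iI ZX; have iB := subsetP IB _ iI.
    have ZE : (i |: Z) :\: B k = Z.
      apply/setP => x; rewrite !inE; case: (eqVneq x i) => [->|_] /=.
        by rewrite iB /=; apply/esym/negP => /(subsetP ZX); rewrite inE iB.
      by rewrite andb_idl // => /(subsetP ZX); rewrite inE => /andP[].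
    have ZI : (i |: Z) :&: B k = [set i].
      apply/setP => x; rewrite !inE; case: (eqVneq x i) => [->|_] //=.
      by apply/negP => /andP[/(subsetP ZX)]; rewrite inE => /andP[/negPf ->].
    rewrite (_ : F Z = F (i |: Z)).
      apply: IH; have := cX Z ZX; rewrite cY cardsU1; move: I2.
      by case: (i \in Z) => /=; clear; lia.
    rewrite (total_exponent_split k (i |: Z)) ZE ZI (@brick_small k) ?sub1set ?cards1 //.
  - exact: (gradedB IB).
have int1 k : interlace_like (B k) -> (#|Y :&: B k| <= 1)%N.
  by move=> intB; rewrite leqNgt; apply/negP => h; apply: nint; exists k.
have [[k [laceB BY]]|nlace] := classic (exists k, lace_like (B k) /\ B k \subset Y).
  have /subsetPn[r rY rB] := nsub k.
  exact: eqminor_total_lace laceB BY rY rB.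
have lace0 k : lace_like (B k) -> ~~ (B k \subset Y).
  by move=> laceB; apply/negP => h; apply: nlace; exists k.
suff -> : F Y = 0%N by apply: mutualB.
apply: big1 => k _; case: (kindB k) => [e0|laceB|intB].
- have S0 := word_system0 A01 (nzminor_all (B k)) (@gradedB k).
  by apply/eqP; rewrite -leqn0 -e0; apply: (ws_mono S0) => //; apply: subsetIr.
- apply: laceB.2; rewrite properEneq subsetIr andbT.
  by apply: contra (lace0 k laceB) => /eqP/setIidPr.
- by apply: (@brick_small k); [apply: subsetIr|apply: int1].
Qed.

End Assembly.

(** * Total equimodularity in terms of row sets *)
Local Notation RR := Rdefinitions.R.

Section Selections.
Variable F : realFieldType.

Lemma incr_inj k m (f : 'I_k -> 'I_m) : incr f -> injective f.
Proof.
by move=> fi i j e; case: (ltngtP i j) => [/fi|/fi|/val_inj //]; rewrite e ltnn.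
Qed.

Lemma incr_enum m (S : {set 'I_m}) : exists2 g : 'I_#|S| -> 'I_m, incr g & [set g l | l in 'I_#|S|] = S.
Proof.
exists enum_val => [i j ij|]; last first.
  apply/setP => x; apply/imsetP/idP => [[l _ ->]|xS]; first exact: enum_valP.
  by exists (enum_rank_in xS x); rewrite ?enum_rankK_in.
have srt : sorted ltn (map val (enum S)).
  rewrite sorted_map /enum_mem; apply: sorted_filter; first by move=> x y z /=; apply: ltn_trans.
  by rewrite -enumT -sorted_map val_enum_ord iota_ltn_sorted.
have x0 := enum_val i.
have szE : size (map val (enum S)) = #|S| by rewrite size_map -cardE.
rewrite !(enum_val_nth x0) -!(nth_map x0 0%N val) -?cardE ?ltn_ord //.
by rewrite (sorted_ltn_nth ltn_trans) // inE szE.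
Qed.

(** A nonzero minor has distinct columns, and sorting them changes only its sign. This reconciles
    arbitrary column choices with the increasing ones of the definitions. *)
Lemma incr_minor k m (P : 'M[F]_(k, m)) (f : 'I_k -> 'I_m) : \det (colsub f P) != 0 ->
  exists2 g, incr g & `|\det (colsub g P)| = `|\det (colsub f P)|.
Proof.
move=> nz; have fI : injective f.
  move=> i j fij; apply/eqP; apply: contraT => ij; move: nz.
  by rewrite -det_tr (determinant_alternate ij) ?eqxx // => l; rewrite !mxE fij.
have cS : #|[set f l | l in 'I_k]| = k by rewrite card_imset ?card_ord.
have [g gi gS] := incr_enum [set f l | l in 'I_k].
move: g gi gS; rewrite cS => g gi gS; exists g => //.
have /fin_all_exists[s sE] : forall l, exists l', g l' = f l.
  move=> l; have : f l \in [set g l' | l' in 'I_k] by rewrite gS imset_f.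
  by case/imsetP=> l' _ ->; exists l'.
have sI : injective s by move=> a b e; apply: fI; rewrite -!sE e.
have -> : colsub f P = col_perm (perm sI) (colsub g P).
  by apply/matrixP => i j; rewrite !mxE permE sE.
by rewrite col_permE det_mulmx det_perm normrM normrX normrN1 expr1n mulr1.
Qed.

Lemma row_free_rowsub k m q (P : 'M[F]_(m, q)) (h : 'I_k -> 'I_m) : injective h ->
  row_free P -> row_free (rowsub h P).
Proof.
move=> hI fP; rewrite rowsubE /row_free mxrankMfree //; apply/row_freeP.
exists (rowsub h 1%:M)^T; apply/matrixP => i j; rewrite !mxE (bigD1 (h i)) //= big1 => [|l li].
  by rewrite !mxE eqxx mul1r addr0 eq_sym (inj_eq hI).
by rewrite !mxE eq_sym (negPf li) mul0r.
Qed.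

Lemma row_free_nzminor m q (P : 'M[F]_(m, q)) : row_free P -> nzminor P setT.
Proof.
move=> frP; have fP : row_full P^T by rewrite /row_full mxrank_tr.
exists (fullrankfun fP); have := fullrowsub_unit fP.
rewrite unitmxE unitfE -det_tr; congr (_ != 0); congr (\det _).
by apply/matrixP => i j; rewrite !mxE !inE.
Qed.

End Selections.

Section Submatrices.
Variables (p n s : nat) (M : 'M[RR]_(p, n)) (h : 'I_s -> 'I_p).
Hypotheses (hI : injective h) (freeM : row_free M).
Let N := rowsub h M.
Let Y0 := [set h l | l in 'I_s].

Lemma minor_of_sub k (g : 'I_k -> 'I_s) (f : 'I_k -> 'I_n) : injective g ->
  (* [minor] wants a column for every row index; [f0], taken from a nonzero minor of [M], supplies a
     default outside the selected rows, since ['I_n] might be empty. *)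
  exists f', minor M [set h (g l) | l in 'I_k] f' = \det (mxsub g f N).
Proof.
move=> gI; have [f0 _] := row_free_nzminor freeM.
have hgI : injective (h \o g) by apply: inj_comp.
exists (fun i => if [pick l | h (g l) == i] is Some l then f l else f0 i).
rewrite (minor_enum _ _ hgI); congr (\det _); apply/matrixP => i j; rewrite !mxE /=.
case: pickP => [l /eqP/hI/gI ->//|/(_ j)]; by rewrite eqxx.
Qed.

Lemma subset_selection (Y : {set 'I_p}) : Y \subset Y0 ->
  exists k (g : 'I_k -> 'I_s), incr g /\ [set h (g l) | l in 'I_k] = Y.
Proof.
move=> YY0; have [g gi gS] := incr_enum (h @^-1: Y).
exists #|h @^-1: Y|, g; split=> //.
rewrite (imset_comp h g) gS; apply/setP => i; apply/imsetP/idP => [[l]|iY].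
  by rewrite inE => hl ->.
by have /imsetP[l _ il] := subsetP YY0 i iY; exists l; rewrite // inE -il.
Qed.

Lemma sub_of_minor k (g : 'I_k -> 'I_s) f : injective g ->
  minor M [set h (g l) | l in 'I_k] f != 0 ->
  exists2 f', incr f' & `|\det (mxsub g f' N)| = `|minor M [set h (g l) | l in 'I_k] f|.
Proof.
move=> gI; have hgI : injective (h \o g) by apply: inj_comp.
rewrite (minor_enum _ _ hgI).
have cE (f' : 'I_k -> 'I_n) : mxsub g f' N = colsub f' (rowsub (h \o g) M).
  by apply/matrixP => i j; rewrite !mxE.
have -> : mxsub (h \o g) (f \o (h \o g)) M = colsub (f \o (h \o g)) (rowsub (h \o g) M).
  by apply/matrixP => i j; rewrite !mxE.
by move=> /incr_minor[f' fi e]; exists f'; rewrite // cE.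
Qed.

Lemma totally_equimodularP :
  totally_equimodular N <-> (forall Y : {set 'I_p}, Y \subset Y0 -> exists d, eqminor M Y d).
Proof.
split=> [te Y YY0|te k g gi free].
  have [k [g [gi gY]]] := subset_selection YY0; have gI := incr_inj gi.
  have free : row_free (rowsub g N).
    by apply: row_free_rowsub gI _; apply: row_free_rowsub hI freeM.
  have [f0 nz0] := nzminor_sub (subsetT Y) (row_free_nzminor freeM).
  exists `|minor M Y f0| => f nz; rewrite -gY in nz nz0 *.
  have [f1 i1 e1] := sub_of_minor gI nz; have [f2 i2 e2] := sub_of_minor gI nz0.
  have [_ /(_ f1 f2 i1 i2)] := te k g gi free.
  have cE (f' : 'I_k -> 'I_n) : colsub f' (rowsub g N) = mxsub g f' N.
    by apply/matrixP => i j; rewrite !mxE.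
  rewrite !cE -e1 -e2; apply.
    by rewrite -normr_eq0 e1 normr_eq0.
  by rewrite -normr_eq0 e2 normr_eq0.
split=> // f1 f2 i1 i2; have gI := incr_inj gi.
have [|d ed] := te [set h (g l) | l in 'I_k].
  by apply/subsetP => _ /imsetP[l _ ->]; apply: imset_f.
have cE (f' : 'I_k -> 'I_n) : colsub f' (rowsub g N) = mxsub g f' N.
  by apply/matrixP => i j; rewrite !mxE.
have [f1' e1] := minor_of_sub f1 gI; have [f2' e2] := minor_of_sub f2 gI.
by rewrite !cE -e1 -e2 => /ed -> /ed ->.
Qed.

Lemma unit_sign (x : RR) : x \in [:: 0; 1; -1] <-> (x != 0 -> `|x| = 1).
Proof.
split=> [|x1]; first by move=> x01 /(sign_cases x01)[] ->; rewrite ?normrN normr1.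
have [->|/x1] := eqVneq x 0; first by rewrite inE eqxx.
case: (ger0P x) => _; first by move=> ->; rewrite !inE eqxx orbT.
by move=> /eqP; rewrite eqr_oppLR => /eqP ->; rewrite !inE eqxx !orbT.
Qed.

Lemma totally_unimodularP :
  totally_unimodular N <-> (forall Y : {set 'I_p}, Y \subset Y0 -> eqminor M Y 1).
Proof.
split=> [tu Y YY0 f|tu k g f gi fi].
  have [k [g [gi <-]]] := subset_selection YY0; have gI := incr_inj gi.
  move=> nz; have [f' fi e] := sub_of_minor gI nz.
  rewrite -e; apply/(unit_sign (\det _)).1; first exact: tu.
  by rewrite -normr_eq0 e normr_eq0.
have gI := incr_inj gi; have [f' <-] := minor_of_sub f gI.
apply/unit_sign/tu; by apply/subsetP => _ /imsetP[l _ ->]; apply: imset_f.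
Qed.

Lemma has_eqdetP d : has_eqdet N d <-> eqminor M Y0 d.
Proof.
have freeN : row_free N by apply: row_free_rowsub hI freeM.
have idI : injective (@id 'I_s) by [].
split=> [[_ [_ ed]] f nz|ed].
  have [f' fi e] := sub_of_minor idI nz.
  by rewrite -e; apply: ed; rewrite // -normr_eq0 e normr_eq0.
split=> //; split.
  have [f nz] := nzminor_sub (subsetT Y0) (row_free_nzminor freeM).
  have [f' fi e] := sub_of_minor idI nz.
  by exists f'; split; rewrite // -normr_eq0 e normr_eq0.
by move=> f fi; have [f' <-] := minor_of_sub f idI; apply: ed.
Qed.

End Submatrices.

(** * Sets of vectors as sets of row indices *)

Section RowSets.
Variables (n : nat) (A : {fset vec n}).
Hypothesis indA : indep01 A.
Let p := size (enum_fset A).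
Let M := mx_of A.
Implicit Types (X B : {fset vec n}) (Y C : {set 'I_p}).
Local Open Scope fset_scope.

Definition row_vec (i : 'I_p) : vec n := nth 0 (enum_fset A) i.
Definition row_idx X : {set 'I_p} := [set i | row_vec i \in X]%SET.
Definition row_fset Y : {fset vec n} := [fset row_vec i | i in Y].

Lemma row_vec_mem i : row_vec i \in A.
Proof. exact: mem_nth. Qed.

Lemma row_vec_inj : injective row_vec.
Proof. by move=> i j /eqP; rewrite nth_uniq ?fset_uniq // => /eqP/val_inj. Qed.

Lemma row_vec_surj v : v \in A -> exists i, row_vec i = v.
Proof.
move=> vA; have iv : (index v (enum_fset A) < p)%N by rewrite index_mem.
by exists (Ordinal iv); rewrite /row_vec nth_index.
Qed.

Lemma row_idxK Y : row_idx (row_fset Y) = Y.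
Proof.
apply/setP => i; rewrite inE; apply/imfsetP/idP => [[j /= jY /row_vec_inj ->//]|iY].
by exists i.
Qed.

Lemma row_fset_sub Y : row_fset Y `<=` A.
Proof. by apply/fsubsetP => _ /imfsetP[i _ ->]; apply: row_vec_mem. Qed.

Lemma row_fsetK X : X `<=` A -> row_fset (row_idx X) = X.
Proof.
move=> /fsubsetP XA; apply/fsetP => v; apply/imfsetP/idP => [[i /=]|vX].
  by rewrite inE => iX ->.
by have [i iv] := row_vec_surj (XA v vX); exists i; rewrite //= inE iv.
Qed.

Lemma row_idx_all : row_idx A = setT.
Proof. by apply/setP => i; rewrite !inE row_vec_mem. Qed.

Lemma row_idxS X X' : X `<=` A -> (row_idx X \subset row_idx X') = (X `<=` X').
Proof.
move=> XA; apply/subsetP/fsubsetP => [s v vX|s i]; last by rewrite !inE; apply: s.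
have [i iv] := row_vec_surj (fsubsetP XA v vX).
by have := s i; rewrite !inE iv; apply.
Qed.

Lemma card_row_idx X : X `<=` A -> #|` X| = #|row_idx X|.
Proof.
by move=> XA; rewrite -{1}(row_fsetK XA) card_imfset ?cardE //; apply: row_vec_inj.
Qed.

Lemma row_idxI X X' : row_idx (X `&` X') = row_idx X :&: row_idx X'.
Proof. by apply/setP => i; rewrite !inE. Qed.

Lemma sub_rows X : X `<=` A -> exists h : 'I_(size (enum_fset X)) -> 'I_p,
  [/\ injective h, mx_of X = rowsub h M & [set h l | l in 'I__]%SET = row_idx X].
Proof.
move=> /fsubsetP XA.
have /fin_all_exists[h hE] : forall k : 'I_(size (enum_fset X)), exists i, row_vec i = nth 0 (enum_fset X) k.
  by move=> k; apply/row_vec_surj/XA/mem_nth.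
exists h; split.
- move=> k l e; have /eqP : nth 0 (enum_fset X) k = nth 0 (enum_fset X) l by rewrite -!hE e.
  by rewrite nth_uniq ?fset_uniq // => /eqP/val_inj.
- by apply/matrixP => i j; rewrite !mxE -hE.
- apply/setP => i; rewrite inE; apply/imsetP/idP => [[k _ ->]|iX]; first by rewrite hE; apply: mem_nth.
  have ik : (index (row_vec i) (enum_fset X) < size (enum_fset X))%N by rewrite index_mem.
  by exists (Ordinal ik) => //; apply: row_vec_inj; rewrite hE nth_index.
Qed.

Lemma mx_of01 i c : M i c \in [:: 0; 1; -1].
Proof. by rewrite mxE; apply: (indA.1 _ (row_vec_mem i)). Qed.

Lemma nzminor_rows Y : nzminor M Y.
Proof. exact: nzminor_sub (subsetT Y) (row_free_nzminor indA.2). Qed.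

Lemma indep01_sub X : X `<=` A -> indep01 X.
Proof.
move=> XA; have [h [hI E _]] := sub_rows XA.
split; last by rewrite E; exact: row_free_rowsub hI indA.2.
by move=> v /(fsubsetP XA); apply: indA.1.
Qed.

Lemma te_setP X : X `<=` A ->
  te_set X <-> (forall Y, Y \subset row_idx X -> exists d, eqminor M Y d).
Proof.
move=> XA; have iX := indep01_sub XA.
have [h [hI E hX]] := sub_rows XA; rewrite -hX.
by split=> [[_]|te]; [|split=> //]; rewrite E totally_equimodularP //; apply: indA.2.
Qed.

Lemma tu_setP X : X `<=` A ->
  tu_set X <-> (forall Y, Y \subset row_idx X -> eqminor M Y 1).
Proof.
move=> XA; have iX := indep01_sub XA.
have [h [hI E hX]] := sub_rows XA; rewrite -hX.
by split=> [[_]|te]; [|split=> //]; rewrite E totally_unimodularP //; apply: indA.2.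
Qed.

Lemma has_eqdet_rows X d : X `<=` A -> has_eqdet (mx_of X) d <-> eqminor M (row_idx X) d.
Proof.
move=> XA; have [h [hI E hX]] := sub_rows XA; rewrite -hX E.
by apply: has_eqdetP => //; apply: indA.2.
Qed.

Lemma tu_exponent X e : X `<=` A -> graded M e (row_idx X) -> tu_set X <-> e (row_idx X) = 0%N.
Proof.
move=> XA eX; rewrite tu_setP //; split=> [tu|e0 Y YX].
  by apply/(graded_eq0 (nzminor_rows _) eX (subxx _)); apply: tu.
apply/(graded_eq0 (nzminor_rows _) eX YX)/eqP; rewrite -leqn0 -e0.
exact: (graded_mono mx_of01 (nzminor_rows _) eX YX (subxx _)).
Qed.

Lemma te_graded_rows X : X `<=` A -> te_set X ->
  forall Y, Y \subset row_idx X -> exists k, eqminor M Y (pow2 RR k).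
Proof.
move=> XA /(te_setP XA) te Y YX; apply: (te_pow2_exists mx_of01 (nzminor_rows Y)).
by move=> Z ZY; apply: te; apply: subset_trans YX.
Qed.

Lemma te_lace_like X e : X `<=` A -> graded M e (row_idx X) -> te_lace X -> lace_like e (row_idx X).
Proof.
move=> XA eX [_ [ntu tuX]]; split.
  by rewrite lt0n; apply/eqP => /(tu_exponent XA eX).
move=> Y YX; have YX' := proper_sub YX.
have sub : row_fset Y `<=` X by rewrite -row_idxS ?row_fset_sub // row_idxK.
have eY : graded M e (row_idx (row_fset Y)).
  by move=> Z; rewrite row_idxK => ZY; apply: eX; apply: subset_trans YX'.
rewrite -(row_idxK Y); apply/(tu_exponent (row_fset_sub _) eY)/tuX.
rewrite fproperEneq sub andbT; apply/eqP => E.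
by move: YX; rewrite -(row_idxK Y) E properxx.
Qed.

Lemma row_idx2 x y : row_idx [fset row_vec x; row_vec y] = [set x; y]%SET.
Proof. by apply/setP => i; rewrite !inE !(inj_eq row_vec_inj). Qed.

Lemma te_interlace_like X e : X `<=` A -> graded M e (row_idx X) -> te_interlace X ->
  interlace_like e (row_idx X).
Proof.
move=> XA eX [_ [_ pairs]] x y xX yX xy; rewrite lt0n; apply/eqP => e0.
have vX : row_vec x \in X by move: xX; rewrite inE.
have wX : row_vec y \in X by move: yX; rewrite inE.
have vw : row_vec x != row_vec y by rewrite (inj_eq row_vec_inj).
have [_ [ntu _]] := pairs _ _ vX wX vw.
apply: ntu; apply/(@tu_exponent _ e); rewrite ?row_idx2 //.
  by apply/fsubsetP => v; rewrite !inE => /orP[] /eqP ->; apply: row_vec_mem.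
move=> Z Zxy; apply: eX; apply: subset_trans Zxy _.
by apply/subsetP => i; rewrite !inE => /orP[] /eqP ->.
Qed.

End RowSets.

(** * The decomposition *)
Lemma count_two (T : Type) (x0 : T) (a : pred T) (s : seq T) i j : i <> j ->
  (i < size s)%N -> (j < size s)%N -> a (nth x0 s i) -> a (nth x0 s j) -> (2 <= count a s)%N.
Proof.
move=> ij si sj ai aj; rewrite -sum1_count (big_nth x0) big_mkord.
rewrite (bigD1 (Ordinal si)) //= (bigD1 (Ordinal sj)) //= aj -val_eqE /=.
by apply/eqP => ji; apply: ij.
Qed.

(** * Mutually-tu bricks form a te-set *)

Section FromBricks.
Variables (n : nat) (A : {fset vec n}).
Hypothesis indA : indep01 A.
Local Open Scope fset_scope.

Lemma te_of_bricks (bs : seq {fset vec n}) : (0 < size bs)%N -> pairwise_disjoint bs ->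
  A = \bigcup_(B <- bs) B -> mutually_tu bs ->
  (forall B, B \in bs -> [\/ tu_set B, te_lace B | te_interlace B]) -> te_set A.
Proof.
move=> bs0 dis AE mut kind.
have subA B : B \in bs -> B `<=` A.
  by move=> Bbs; apply/fsubsetP => v vB; rewrite AE; apply/bigfcupP; exists B; rewrite ?Bbs.
have cov v : v \in A -> exists2 B, B \in bs & v \in B.
  by rewrite {1}AE => /bigfcupP[B]; rewrite andbT; exists B.
pose b k := nth fset0 bs k.
have bbs (k : 'I_(size bs)) : b k \in bs by apply: mem_nth.
have bA (k : 'I_(size bs)) := subA _ (bbs k).
pose Bk (k : 'I_(size bs)) := row_idx A (b k).
have teb B : B \in bs -> te_set B.
  move=> Bbs; case: (kind B Bbs) => [tu|[]//|[]//].
  by apply/(te_setP indA (subA B Bbs)) => Y YB; exists 1; apply: (tu_setP indA (subA B Bbs)).1.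
(* One exponent function serves all bricks, because the exponent of [Y] does not depend on the brick
   that contains it. Sets inside no brick get the dummy value 0. *)
have /fin_all_exists[e eP] : forall Y : {set 'I_(size (enum_fset A))}, exists q,
    forall k, Y \subset Bk k -> eqminor (mx_of A) Y (pow2 RR q).
  move=> Y; have [[k Yk]|nk] := classic (exists k, Y \subset Bk k).
    by have [q eq] := te_graded_rows indA (bA k) (teb _ (bbs k)) Yk; exists q.
  by exists 0%N => k Yk; case: nk; exists k.
have gr k : graded (mx_of A) e (Bk k) by move=> Y; apply: eP.
have disj k l : k != l -> [disjoint Bk k & Bk l]%bool.
  move=> kl; rewrite -setI_eq0 -row_idxI.
  have kl' : k <> l :> nat by move=> /val_inj/eqP; rewrite (negPf kl).
  have -> : b k `&` b l = fset0 := dis k l (ltn_ord k) (ltn_ord l) kl'.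
  by apply/eqP/setP => i; rewrite !inE.
have kindk k : [\/ e (Bk k) = 0%N, lace_like e (Bk k) | interlace_like e (Bk k)].
  case: (kind _ (bbs k)) => [tu|la|il].
  - by constructor 1; apply/(tu_exponent indA (bA k) (gr k)).
  - by constructor 2; apply: (te_lace_like indA (bA k) (gr k)).
  - by constructor 3; apply: (te_interlace_like indA (bA k) (gr k)).
apply/(te_setP indA (fsubset_refl A)) => Y0 _.
exists (pow2 RR (total_exponent Bk e Y0)); move: Y0.
apply: (eqminor_total (mx_of01 indA) (nzminor_rows indA setT) disj gr kindk).
move=> Y nsub nlace nint.
have YA := @row_fset_sub _ A Y.
suff tuY : tu_set (row_fset Y) by apply: (tu_setP indA YA).1 => //; rewrite row_idxK.
have idxb B : B \in bs -> exists2 k, row_idx A B = Bk k & B = b k.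
  move=> Bbs; have kb : (index B bs < size bs)%N by rewrite index_mem.
  by exists (Ordinal kb); rewrite /Bk /b /= nth_index.
apply: mut.
- by rewrite -AE.
(* There is at least one brick, so a set contained in none is nonempty. The brick of one of its
   elements does not contain it, and this gives a second brick that it meets. *)
- have /subsetPn[x xY _] := nsub (Ordinal bs0).
  have cov' y : exists k, y \in Bk k.
    have [B /idxb[k Ek Eb] yB] := cov _ (row_vec_mem y).
    by exists k; rewrite -Ek inE.
  have [k xk] := cov' x; have /subsetPn[y yY yk] := nsub k; have [l yl] := cov' y.
  have meet z m : z \in Y -> z \in Bk m -> row_fset Y `&` b m != fset0.
    move=> zY zm; apply/fset0Pn; exists (row_vec z); rewrite in_fsetI.
    by move: zm; rewrite inE => ->; rewrite andbT; apply/imfsetP; exists z.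
  apply: (@count_two _ fset0 _ _ k l) => //; last exact: meet yY yl.
    by move=> /val_inj kl; rewrite kl yl in yk.
  exact: meet xY xk.
- move=> B Bbs la; have [k Ek Eb] := idxb B Bbs; apply/negP.
  rewrite -(row_idxS (A := A)) ?subA // row_idxK Ek; apply: nlace.
  by rewrite -Ek; apply: (te_lace_like indA (subA B Bbs) _ la); rewrite Ek.
- move=> B Bbs il; have [k Ek Eb] := idxb B Bbs.
  rewrite (card_row_idx (A := A)); last by apply: fsubset_trans (fsubsetIr _ _) (subA B Bbs).
  rewrite row_idxI row_idxK Ek; apply: nint.
  by rewrite -Ek; apply: (te_interlace_like indA (subA B Bbs) _ il); rewrite Ek.
Qed.

End FromBricks.

(** * Candidate bricks: large circuits and parallel classes *)

Section ParallelClasses.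
Variables (R : archiRealFieldType) (p n : nat) (A : 'M[R]_(p, n)).
Variables (e : {set 'I_p} -> nat).
Hypothesis S0 : word_system A setT e (even_word A).
Implicit Types (C D E : {set 'I_p}).
Local Notation circ := (circuit setT e).

Definition parallel_class i := [set j | (j == i) || circ [set i; j]].

Lemma parallel_refl i : i \in parallel_class i.
Proof. by rewrite inE eqxx. Qed.

Lemma parallel_sym i j : j \in parallel_class i -> i \in parallel_class j.
Proof. by rewrite !inE eq_sym setUC. Qed.

Lemma parallel_trans i j k : j \in parallel_class i -> k \in parallel_class j -> k \in parallel_class i.
Proof.
rewrite !inE; have [->//|ji] := eqVneq j i; have [->|kj] := eqVneq k j; first by rewrite (negPf ji).
have [->//|ki /=] := eqVneq k i.
by apply: (pair_circuit_trans S0); rewrite eq_sym.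
Qed.

Lemma parallel_class_eq i j : j \in parallel_class i -> parallel_class j = parallel_class i.
Proof.
move=> ji; have ij := parallel_sym ji; apply/setP => k.
by apply/idP/idP; apply: parallel_trans.
Qed.

Lemma parallel_pair i x y : x \in parallel_class i -> y \in parallel_class i -> x != y -> circ [set x; y].
Proof.
move=> xi yi xy; move: yi; rewrite -(parallel_class_eq xi) inE => /orP[/eqP yx|//].
by rewrite yx eqxx in xy.
Qed.

Lemma parallel_interlace i : interlace_like e (parallel_class i).
Proof. by move=> x y xi yi xy; apply: circuit_pos (parallel_pair xi yi xy). Qed.

Definition big_circuit C := circ C && (2 < #|C|)%N.

(** Two-element circuits are left to the parallel classes, so a class that is a single pair counts
    as an interlace and not as a lace; this keeps the bricks disjoint. *)
Definition nontrivial_bricks : {set {set 'I_p}} :=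
  [set C | big_circuit C || ((1 < #|C|)%N && [exists i, C == parallel_class i])].
Local Notation bricks := nontrivial_bricks.

Lemma bricks_parallel C : C \in bricks -> ~~ big_circuit C ->
  (1 < #|C|)%N /\ exists i, C = parallel_class i.
Proof.
rewrite inE => /orP[->//|/andP[C1 /existsP[i /eqP Ci]] _].
by split=> //; exists i.
Qed.

Lemma big_circuit_parallel_disjoint C i : big_circuit C -> (1 < #|parallel_class i|)%N ->
  [disjoint C & parallel_class i].
Proof.
case/andP=> cC C3 c1; apply: contraT => /pred0Pn[k /= /andP[kC ki]].
have ck : (1 < #|parallel_class k|)%N by rewrite (parallel_class_eq ki).
have [y] : exists y, y \in parallel_class k :\ k.
  by apply/set0Pn; rewrite -card_gt0; move: ck; rewrite (cardsD1 k) parallel_refl.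
rewrite !inE => /andP[yk]; rewrite (negPf yk) /= => cky.
have ne : C != [set k; y].
  by apply: contraTneq C3 => ->; rewrite cards2 eq_sym yk.
have [|C2 _] := circuits_meet S0 cC cky ne.
  by apply/pred0Pn; exists k; rewrite /= kC !inE eqxx.
by rewrite C2 in C3.
Qed.

Lemma bricks_disjoint C D : C \in bricks -> D \in bricks -> C != D -> [disjoint C & D].
Proof.
move=> Cb Db ne.
have [bC|nC] := boolP (big_circuit C); have [bD|nD] := boolP (big_circuit D).
- apply: contraT => meet; case/andP: bC => cC C3; case/andP: bD => cD _.
  by have [C2 _] := circuits_meet S0 cC cD ne meet; rewrite C2 in C3.
- have [D1 [i Di]] := bricks_parallel Db nD.
  by rewrite Di; apply: big_circuit_parallel_disjoint; rewrite -?Di.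
- have [C1 [i Ci]] := bricks_parallel Cb nC.
  by rewrite disjoint_sym Ci; apply: big_circuit_parallel_disjoint; rewrite -?Ci.
have [_ [i Ci]] := bricks_parallel Cb nC; have [_ [j Dj]] := bricks_parallel Db nD.
apply: contraT => /pred0Pn[k /= /andP[]]; rewrite Ci Dj => ki kj.
by rewrite Ci Dj -(parallel_class_eq ki) -(parallel_class_eq kj) eqxx in ne.
Qed.

Lemma circuit_in_brick C : circ C ->
  (C \in bricks /\ big_circuit C) \/ (exists D, [/\ D \in bricks, ~~ big_circuit D, C \subset D & (1 < #|C|)%N]).
Proof.
move=> cC; have [C3|] := ltnP 2 #|C|; first by left; rewrite inE /big_circuit cC C3.
have [x xC] := circuit_nonempty S0 cC.
have [y yC yx] := ws_two S0 x (circuit_sub cC) (circuit_pos cC).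
have xyC : [set x; y] \subset C by apply/subsetP => k; rewrite !inE => /orP[] /eqP ->.
have xy2 : #|[set x; y]| = 2%N by rewrite cards2 eq_sym yx.
move=> C2; have CE : C = [set x; y] by apply/esym/eqP; rewrite eqEcard xyC xy2 C2.
have Cx : C \subset parallel_class x.
  by rewrite CE; apply/subsetP => k; rewrite !inE => /orP[->//|/eqP ->]; rewrite -CE cC orbT.
have C1 : (1 < #|C|)%N by rewrite CE xy2.
have x1 : (1 < #|parallel_class x|)%N by apply: leq_trans C1 (subset_leq_card Cx).
right; exists (parallel_class x); split=> //.
  by rewrite inE x1; apply/orP; right; apply/existsP; exists x.
apply/negP => bx; have := big_circuit_parallel_disjoint bx x1.
by move/disjointFr/(_ (parallel_refl x)); rewrite parallel_refl.
Qed.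

End ParallelClasses.

(** * Decomposing a te-set into bricks *)

Section ToBricks.
Variables (n : nat) (A : {fset vec n}).
Hypothesis indA : indep01 A.
Local Notation p := (size (enum_fset A)).
Local Notation M := (mx_of A).
Implicit Types (X B : {fset vec n}) (Y C : {set 'I_p}).
Local Open Scope fset_scope.
Variable e : {set 'I_p} -> nat.
Hypothesis eA : graded M e setT.

Let S0 : word_system M setT e (even_word M) := word_system0 (mx_of01 indA) (nzminor_rows indA setT) eA.
Local Notation circ := (circuit setT e).

Lemma graded_sub Y : graded M e Y.
Proof. by move=> Z _; apply: eA; apply: subsetT. Qed.

Lemma te_set_sub X : X `<=` A -> te_set X.
Proof.
move=> XA; apply/(te_setP indA XA) => Y _.
by exists (pow2 RR (e Y)); apply: eA; apply: subsetT.
Qed.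

Lemma tu_set_sub X : X `<=` A -> tu_set X <-> e (row_idx A X) = 0%N.
Proof. by move=> XA; apply: tu_exponent => //; apply: graded_sub. Qed.

Lemma te_lace_circuit C : circ C -> te_lace (row_fset C).
Proof.
move=> cC; have CA := row_fset_sub C; split; first exact: te_set_sub.
split=> [|B BC].
  by move/(tu_set_sub CA); rewrite row_idxK => e0; have := circuit_pos cC; rewrite e0.
have BC' := fproper_sub BC; have BA := fsubset_trans BC' CA.
apply/(tu_set_sub BA)/(circuit_proper S0 cC).
rewrite properEneq -{2}(row_idxK C) row_idxS // BC' andbT.
by apply: contraTneq BC => BE; rewrite -BE row_fsetK // fproperEneq eqxx.
Qed.

Lemma te_interlace_parallel i : (1 < #|parallel_class e i|)%N ->
  te_interlace (row_fset (parallel_class e i)).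
Proof.
move=> c1; have CA := row_fset_sub (parallel_class e i).
have pair a b : a \in row_fset (parallel_class e i) -> b \in row_fset (parallel_class e i) -> a != b ->
    te_lace [fset a; b].
  move=> /imfsetP[x /= xi ->] /imfsetP[y /= yi ->]; rewrite (inj_eq (@row_vec_inj _ _)) => xy.
  have -> : [fset row_vec x; row_vec y] = row_fset [set x; y]%SET.
    by rewrite -[LHS](@row_fsetK _ A) ?row_idx2 //; apply/fsubsetP => v; rewrite !inE => /orP[] /eqP ->; apply: row_vec_mem.
  exact: te_lace_circuit (parallel_pair S0 xi yi xy).
split; first exact: te_set_sub.
split=> //; move/(tu_set_sub CA); rewrite row_idxK => e0.
have [y] : exists y, y \in (parallel_class e i :\ i)%SET.
  by apply/set0Pn; rewrite -card_gt0; move: c1; rewrite (cardsD1 i) parallel_refl.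
rewrite in_setD1 => /andP[yi yI].
have := parallel_interlace S0 (parallel_refl e i) yI; rewrite eq_sym => /(_ yi).
have : (e [set i; y]%SET <= e (parallel_class e i))%N.
  apply: (ws_mono S0); last exact: subsetT.
  by apply/subsetP => k; rewrite in_set2 => /orP[] /eqP ->; rewrite ?parallel_refl.
by rewrite e0 leqn0 => /eqP ->.
Qed.

Lemma parallel_exponent i :
  e (parallel_class e i) = #|parallel_class e i|.-1 \/ e (parallel_class e i) = #|parallel_class e i|.-1.+1.
Proof.
apply: (@interlace_exponent _ _ _ M (mx_of01 indA) e (parallel_class e i)) => //.
- exact: nzminor_rows indA _.
- exact: graded_sub.
- exact: parallel_interlace S0 _.
Qed.

Lemma has_eqdet_row_fset C k : e C = k -> has_eqdet (mx_of (row_fset C)) (2 ^+ k).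
Proof.
move=> <-; apply/(has_eqdet_rows indA _ (row_fset_sub C)); rewrite row_idxK.
exact: graded_sub.
Qed.

Lemma card_row_fset C : #|` row_fset C| = #|C|.
Proof. by rewrite (card_row_idx (row_fset_sub C)) row_idxK. Qed.

Lemma bricks_of_te : exists (U : {fset vec n}) (Ls Ss Ts : seq {fset vec n}),
  tu_set U /\ (forall L, L \in Ls -> te_lace L) /\
  (forall S, S \in Ss -> thin_te_interlace S) /\ (forall T, T \in Ts -> thick_te_interlace T) /\
  pairwise_disjoint (U :: Ls ++ Ss ++ Ts) /\ A = \bigcup_(B <- U :: Ls ++ Ss ++ Ts) B /\
  mutually_tu (U :: Ls ++ Ss ++ Ts).
Proof.
pose D := nontrivial_bricks e; pose big := big_circuit e.
pose thin (C : {set 'I_p}) := e C == #|C|.-1.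
have [de de_uniq deE] : exists2 de : seq {set 'I_p}, uniq de & de =i D.
  by exists (enum D); [apply: enum_uniq|apply: mem_enum].
pose Ls0 := [seq C <- de | big C].
pose Ss0 := [seq C <- de | ~~ big C && thin C].
pose Ts0 := [seq C <- de | ~~ big C && ~~ thin C].
pose U0 := ~: \bigcup_(C in D) C.
pose dl := Ls0 ++ Ss0 ++ Ts0.
have dlD C : (C \in dl) = (C \in D).
  rewrite !mem_cat !mem_filter !deE; case: (C \in D); rewrite ?andbF // !andbT.
  by case: (big C); case: (thin C).
have dlu : uniq dl.
  rewrite !cat_uniq !filter_uniq ?//= andbT -!all_predC; apply/andP; split; apply/allP => C.
    rewrite /= mem_cat !mem_filter => /orP[] /andP[/andP[/negPf -> _] _] //.
  by rewrite /= !mem_filter => /andP[/andP[_ /negPf ->] _]; rewrite andbF.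
have mapE : row_fset U0 :: map (@row_fset n A) Ls0 ++ map (@row_fset n A) Ss0 ++ map (@row_fset n A) Ts0
    = map (@row_fset n A) (U0 :: dl) by rewrite /= !map_cat.
exists (row_fset U0), (map (@row_fset n A) Ls0), (map (@row_fset n A) Ss0), (map (@row_fset n A) Ts0).
have laceL L : L \in map (@row_fset n A) Ls0 -> te_lace L.
  by case/mapP=> C; rewrite mem_filter => /andP[/andP[cC _] _] ->; apply: te_lace_circuit.
have interI C : C \in D -> ~~ big C -> te_interlace (row_fset C).
  by move=> CD nC; have [C1 [i Ci]] := bricks_parallel CD nC; rewrite Ci in C1 *; apply: te_interlace_parallel.
have notbig C : C \in D -> ~~ big C -> row_fset C \in map (@row_fset n A) Ss0 ++ map (@row_fset n A) Ts0.
  move=> CD nC; rewrite mem_cat; case tC: (thin C); [apply/orP; left|apply/orP; right];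
    by apply: map_f; rewrite mem_filter nC tC deE.
split.
  apply/(tu_set_sub (row_fset_sub _)); rewrite row_idxK; apply/eqP; rewrite -leqn0 leqNgt.
  apply/negP => /(circuit_exists (subsetT _))[C CU cC].
  have noD E : E \in D -> C \subset E -> False.
    move=> ED CE; have [x xC] := circuit_nonempty S0 cC.
    have := subsetP CU x xC; rewrite inE => /negP; apply.
    by apply/bigcupP; exists E => //; apply: (subsetP CE).
  case: (circuit_in_brick S0 cC) => [[CD _]|[E [ED _ CE _]]]; [exact: noD CD _|exact: noD ED CE].
split=> //; split.
  move=> S /mapP[C]; rewrite mem_filter => /andP[/andP[nC /eqP tC] CD] ->.
  rewrite deE in CD; split; first exact: interI.
  by apply: has_eqdet_row_fset; rewrite card_row_fset.
split.
  move=> T /mapP[C]; rewrite mem_filter => /andP[/andP[nC tC] CD] ->.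
  rewrite deE in CD; split; first exact: interI.
  apply: has_eqdet_row_fset; rewrite card_row_fset.
  have [C1 [i Ci]] := bricks_parallel CD nC; move: tC; rewrite /thin Ci.
  by case: (parallel_exponent i) => ->; rewrite ?eqxx // prednK //; rewrite -Ci; apply: ltnW.
split.
  rewrite mapE => i j; rewrite size_map => si sj ij.
  rewrite !(nth_map set0) //; apply/fsetP => v; rewrite in_fsetI in_fset0; apply/negP.
  case/andP=> /imfsetP[x /= xi ->] /imfsetP[y /= yj] /row_vec_inj xy; subst y.
  have UD C : C \in dl -> x \in U0 -> x \in C -> False.
    by rewrite dlD in_setC => CD /negP nx xC; apply: nx; apply/bigcupP; exists C.
  case: i j si sj ij xi yj => [|i] [|j] //= si sj ij xi xj.
  - exact: UD (mem_nth _ sj) xi xj.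
  - exact: UD (mem_nth _ si) xj xi.
  have ne : nth set0 dl i != nth set0 dl j by rewrite nth_uniq //; apply/eqP => e'; case: ij; rewrite e'.
  have iD : nth set0 dl i \in D by rewrite -dlD mem_nth.
  have jD : nth set0 dl j \in D by rewrite -dlD mem_nth.
  by have := disjointFr (bricks_disjoint S0 iD jD ne) xi; rewrite xj.
split.
  rewrite mapE; apply/fsetP => v; apply/idP/bigfcupP => [|[B]]; last first.
    by rewrite andbT => /mapP[C _ ->]; apply: (fsubsetP (row_fset_sub C)).
  case/row_vec_surj=> x <-.
  have [xU|] := boolP (x \in U0).
    by exists (row_fset U0); [rewrite inE eqxx|apply/imfsetP; exists x].
  rewrite inE negbK => /bigcupP[C CD xC].
  exists (row_fset C); last by apply/imfsetP; exists x.
  by rewrite andbT map_f // inE dlD CD orbT.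
move=> X XA _ nlace nint.
have {}XA : X `<=` A.
  apply: fsubset_trans XA _; apply/fsubsetP => v /bigfcupP[B].
  by rewrite mapE andbT => /mapP[C _ ->]; apply: (fsubsetP (row_fset_sub C)).
(* If [X] were not a tu-set it would contain a circuit. That circuit is either one of the laces, or
   has two elements in one interlace, and both are excluded for [X]. *)
apply/(tu_set_sub XA)/eqP; rewrite -leqn0 leqNgt.
apply/negP => /(circuit_exists (subsetT _))[C CX cC].
case: (circuit_in_brick S0 cC) => [[CD bC]|[E [ED nE CE C1]]].
  apply: (nlace (row_fset C)); last by rewrite -(row_idxS X (row_fset_sub C)) row_idxK.
    by rewrite inE mem_cat map_f ?orbT // mem_filter deE CD andbT.
  exact: te_lace_circuit.
have := nint (row_fset E); rewrite inE mem_cat notbig // !orbT => /(_ isT (interI E ED nE)).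
rewrite (card_row_idx (A := A)); last by apply: fsubset_trans (fsubsetIl _ _) XA.
rewrite row_idxI row_idxK leqNgt => /negP; apply; apply: leq_trans C1 _.
by apply: subset_leq_card; rewrite subsetI CX.
Qed.

End ToBricks.

Local Open Scope fset_scope.

Theorem mainTheorem4 (n : nat) (A : {fset 'rV[Rdefinitions.R]_n}) :
  indep01 A ->
  (te_set A <->
   exists (U : {fset 'rV[Rdefinitions.R]_n}) (Ls Ss Ts : seq {fset 'rV[Rdefinitions.R]_n}),
     tu_set U /\
         (forall L, L \in Ls -> te_lace L) /\
         (forall S, S \in Ss -> thin_te_interlace S) /\
         (forall T, T \in Ts -> thick_te_interlace T) /\
         pairwise_disjoint (U :: Ls ++ Ss ++ Ts) /\
         A = \bigcup_(B <- U :: Ls ++ Ss ++ Ts) B /\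
         mutually_tu (U :: Ls ++ Ss ++ Ts)).
Proof.
move=> indA; split=> [teA|[U [Ls [Ss [Ts [tuU [laL [thS [thT [dis [AE mut]]]]]]]]]]].
  have [e eA] : exists e, graded (mx_of A) e setT.
    apply: (te_graded (mx_of01 indA) (nzminor_rows indA setT)) => Z _.
    by apply: ((te_setP indA (fsubset_refl A)).1 teA); rewrite row_idx_all subsetT.
  exact: (bricks_of_te indA eA).
apply: (te_of_bricks indA _ dis AE mut) => // B; rewrite inE => /orP[/eqP ->|]; first by constructor 1.
rewrite !mem_cat => /or3P[/laL|/thS[]|/thT[]]; [by constructor 2|by constructor 3|by constructor 3].
Qed.
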